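(* There exists a topologically weakly mixing $\mathbb{Z}^3$-subshift of finite type $X$ (with the shift action $\sigma$ of $\mathbb{Z}^3$) in the CPE class $3$; that is, $\mathtt{E}_3(X,\sigma)=X^2$ and $\mathtt{E}_m(X,\sigma)\neq X^2$ for $m\in\{1,2\}$.
   Context: Let $G=\mathbb{Z}^3$. For a finite alphabet $\mathcal A$, a $G$-subshift is a subset $X\subset\mathcal A^{G}$ closed in the product topology and invariant under the shift $\sigma^g(x)_h=x_{g^{-1}h}$; it is of finite type (SFT) if it is the set of all configurations in which no pattern from some fixed finite set of forbidden finite patterns appears. $(X,\sigma)$ is a $G$-topological dynamical system, i.e. a compact metrizable space with a $G$-action $T$ ($=\sigma$) by homeomorphisms. $(X,T)$ is topologically weakly mixing if $(X\times X,T\times T)$ is transitive, i.e. for all non-empty open $U,V\subset X\times X$ there is $g\in G$ with $U\cap (T\times T)^gV\ne\emptyset$. With $\{F_n\}$ a Følner sequence in $G$, for an open cover $\mathcal U$ of $X$ let $h_{\mathrm{top}}(T,\mathcal U)=\lim_n\frac1{|F_n|}\log N(\bigvee_{g\in F_n}T^{g^{-1}}\mathcal U)$, where $N(\cdot)$ is the minimum cardinality of a subcover. A pair $(x,y)\in X^2$ is an entropy pair if $x\neq y$ and for every pair of disjoint closed neighborhoods $U_x,U_y$ of $x$ and $y$ one has $h_{\mathrm{top}}(T,\{X\setminus U_x,X\setminus U_y\})>0$. Let $\mathtt{E}(X,T)$ be the set of entropy pairs and $\Delta$ the diagonal of $X^2$. For $R\subset X^2$, $R^+$ is the smallest equivalence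 relation on $X$ containing $R$. Define $\mathtt{E}_1(X,T)=\mathtt{E}(X,T)\cup\Delta$ and, for integers $n\ge 2$, $\mathtt{E}_n(X,T)=\overline{\mathtt{E}_{n-1}(X,T)}$ if $\mathtt{E}_{n-1}(X,T)$ is not closed, and $\mathtt{E}_n(X,T)=\mathtt{E}_{n-1}(X,T)^+$ otherwise. $(X,T)$ is in the CPE class $n$ if $\mathtt{E}_n(X,T)=X^2$ and $\mathtt{E}_m(X,T)\ne X^2$ for all $1\le m<n$. *)

(* Defs.v *)
From mathcomp Require Import all_boot all_order all_algebra finmap.
From mathcomp Require Import all_classical all_reals all_analysis.

Set Implicit Arguments.
Unset Strict Implicit.
Unset Printing Implicit Defensive.

Import Order.TTheory GRing.Theory Num.Theory.
Import numFieldNormedType.Exports.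

Local Open Scope classical_set_scope.
Local Open Scope ring_scope.

(* The acting group is written additively, so g^-1 h reads h - g. *)

Section FolnerSequences.
Context (R : realType) (G : zmodType).

Definition ftranslate (g : G) (A : {fset G}) : {fset G} :=
  [fset (g + h)%R | h in A]%fset.

Definition fsymdiff (A B : {fset G}) : {fset G} :=
  ((A `\` B) `|` (B `\` A))%fset.

Definition is_folner (F : nat -> {fset G}) : Prop :=
  (forall n, F n <> fset0) /\
  (forall g : G,
     (#|` fsymdiff (ftranslate g (F n)) (F n) |)%:R / (#|` F n |)%:R
       @[n --> \oo] --> (0 : R)).

End FolnerSequences.

Section Transitivity.
Context (G : zmodType).

Definition topologically_transitive (X : topologicalType)
    (T : G -> X -> X) : Prop :=
  forall U V : set X, open U -> open V -> U !=set0 -> V !=set0 ->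
    exists g : G, U `&` (T g @` V) !=set0.

Definition prod_act (X : Type) (T : G -> X -> X) (g : G) (p : X * X) : X * X :=
  (T g p.1, T g p.2).

Definition topologically_weakly_mixing (X : topologicalType)
    (T : G -> X -> X) : Prop :=
  topologically_transitive (prod_act T).

End Transitivity.

Section EntropyPairs.
Context (R : realType) (G : zmodType) (X : topologicalType) (T : G -> X -> X).

Definition subcover_card (U : set (set X)) : set nat :=
  [set k | exists S : set (set X),
     [/\ S `<=` U, \bigcup_(V in S) V = setT & (S #= `I_k)%card]].

(* The value is 0 when there is no finite subcover, which does not happen for
   an open cover of a compact space. *)
Definition cover_number (U : set (set X)) : nat :=
  xget 0%N [set k | subcover_card U k /\
                    forall j, subcover_card U j -> (k <= j)%N].

Definition cover_join (I : choiceType) (D : {fset I})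
    (U : I -> set (set X)) : set (set X) :=
  [set \bigcap_(i in [set` D]) c i |
     c in [set c : I -> set X | forall i, i \in D -> U i (c i)]].

Definition cover_image (g : G) (U : set (set X)) : set (set X) :=
  [set T g @` V | V in U].

(* [limn] is total; for a continuous action on a compact space the limit
   exists along every Folner sequence. *)
Definition htop (F : nat -> {fset G}) (U : set (set X)) : R :=
  limn (fun n =>
    ln (cover_number (cover_join (F n) (fun g => cover_image (- g) U)))%:R
      / (#|` F n |)%:R : R).

Definition entropy_pairs (F : nat -> {fset G}) : set (X * X) :=
  [set p | p.1 <> p.2 /\
     forall Ux Uy : set X,
       closed Ux -> nbhs p.1 Ux -> closed Uy -> nbhs p.2 Uy ->
       Ux `&` Uy = set0 ->
       0 < htop F [set ~` Ux; ~` Uy]].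

Definition is_equivalence (S : set (X * X)) : Prop :=
  [/\ forall x, S (x, x),
      forall x y, S (x, y) -> S (y, x)
    & forall x y z, S (x, y) -> S (y, z) -> S (x, z)].

Definition equiv_closure (S : set (X * X)) : set (X * X) :=
  smallest is_equivalence S.

(* The hierarchy starts at n = 1; index 0 is a dummy value. *)
Fixpoint cpe_rel (F : nat -> {fset G}) (n : nat) : set (X * X) :=
  match n with
  | 0 | 1 => entropy_pairs F `|` [set p | p.1 = p.2]
  | m.+1 => if `[< closed (cpe_rel F m) >] then equiv_closure (cpe_rel F m)
            else closure (cpe_rel F m)
  end.

Definition in_cpe_class (F : nat -> {fset G}) (n : nat) : Prop :=
  cpe_rel F n = setT /\
  (forall m, (1 <= m < n)%N -> cpe_rel F m <> setT).

End EntropyPairs.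

Section Subshifts.
Context (G : zmodType) (A : finType).

Definition config : Type := {ptws G -> discrete_topology A}.

Definition config_shift (g : G) (x : config) : config := fun h => x (h - g).

Record subshift := Subshift {
  subshift_set :> set config;
  subshift_closed : closed subshift_set;
  subshift_invariant :
    forall g x, subshift_set x -> subshift_set (config_shift g x) }.

Definition subshift_act (X : subshift) (g : G) (x : X) : X :=
  SigSub (mem_set (subshift_invariant g (set_valP x))).

Definition pattern : Type := {fmap G -> A}.

Definition appears (p : pattern) (x : config) : Prop :=
  exists g : G, forall h : domf p, x (g + val h) = p h.

Definition is_sft (X : subshift) : Prop :=
  exists P : seq pattern,
    subshift_set X = [set x | forall p, p \in P -> ~ appears p x].

End Subshifts.

(* Main.v *)
Require Import Defs.
From mathcomp Require Import all_boot all_order all_algebra finmap.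
From mathcomp Require Import all_classical all_reals all_analysis.
From mathcomp Require Import zify ring lra.

Set Implicit Arguments.
Unset Strict Implicit.
Unset Printing Implicit Defensive.

Import Order.TTheory GRing.Theory Num.Theory.
Import numFieldNormedType.Exports.

Local Open Scope classical_set_scope.
Local Open Scope ring_scope.

(** The subshift is a sequence of horizontal planes, indexed by the third
    coordinate. Each cell has a hue in [Z/7] and is land or sea. In a plane, the
    connected pieces of land (islands) have a single hue and are triangles with
    their tips at the bottom, possibly infinite: half-planes, wedges, the whole
    plane. Hues of cells above each other differ by at most 1, and the cells above
    and below a sea cell are land. There are triangles of all sizes, so that a large
    pattern does not tell whether the island that contains it is finite, and yet
    triangles of this shape cannot separate two seas: if two adjacent planes both
    had sea cells, then those would come too close to each other ([stack_full]).
    So one of any two adjacent planes is pure, that is, all land of one hue, and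
    all the hues of a plane are within 1 of a center ([plane_center]).

    Entropy pairs change hues little. For hues [a] and [b] at distance more than 2,
    a plane misses [a] or [b], hence the cover by the conditions of not being [a]
    and not being [b] at a given cell needs one choice per plane. A Folner set
    meets few planes for its size, so this cover has zero entropy, and the hues of an entropy
    pair are within 2 at each cell ([entropy_pair_close]). As 7 is large enough,
    the vertical variations of hue, summed over a column as integers, then differ
    by at most 4 at any height ([drift_close]). A finite chain of entropy pairs
    does not join the stack of pure planes of hue [z] at height [z] to the constant
    one, and the equivalence relation generated by the entropy pairs is not
    everything ([cpe2_proper]).

    Conversely, if two points are equal and pure outside of a set of planes no two
    of which are adjacent, they are equal or form an entropy pair: their patterns,
    trimmed to large triangles surrounded by sea, can be laid independently in a
    periodic array of boxes ([isolated_entropy_pair]). So every point equals its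
    purification or makes an entropy pair with it ([purify_pair]), and a stack of
    pure planes given by nonnegative integer heights of finite support can be
    lowered to the flat one, a plane at a time ([flatten_heights]). Any point agrees on a large box with one that reaches
    such a stack, so the generated equivalence relation is dense ([cpe2_dense]).
    The entropy pairs with the diagonal form a closed set ([closed_entropy_pairs]),
    thus the second relation is that equivalence relation, dense and proper, and
    the third one is its closure, everything. Weak mixing holds because two points
    can be glued at a bounded vertical distance ([specification]).

    Entropies are limits along arbitrary Folner sequences, and a positive lower
    bound is of use only once the limit exists. This is the Ornstein-Weiss
    lemma, proved for abelian groups by quasi-tilings ([tower_cover]). *)

(** * Translations of finite sets *)

Section Leaks.
Context (G : zmodType).
Implicit Types (A B K U V : {fset G}) (k g : G).

Definition escape k A : nat := #|` [fset a in A | (k + a)%R \notin A]%fset |.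

Definition leak K A : nat := (\sum_(k <- K) escape k A)%N.

Lemma card_fset_sep A (P : pred G) :
  #|` [fset a in A | P a]%fset | = (\sum_(a <- A) P a)%N.
Proof.
rewrite card_fset_sum1 big_fset /= big_mkcond /=; apply: eq_bigr => a _.
by case: (P a).
Qed.

Lemma card_ftranslate g A : #|` ftranslate g A| = #|` A|.
Proof. by rewrite card_imfset //; exact: addrI. Qed.

Lemma mem_ftranslate g A x : (x \in ftranslate g A) = (x - g \in A).
Proof.
apply/imfsetP/idP => [[h /= hA ->]|xA]; first by rewrite addrC addKr.
by exists (x - g) => //=; rewrite addrC subrK.
Qed.

Lemma escape_ftranslate k g A : escape k (ftranslate g A) = escape k A.
Proof.
rewrite /escape -(card_ftranslate g [fset a in A | (k + a)%R \notin A]%fset).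
congr (#|` _|); apply/fsetP => x.
by rewrite mem_ftranslate !inE /= !mem_ftranslate addrA.
Qed.

Lemma escapeU k A B : (escape k (A `|` B)%fset <= escape k A + escape k B)%N.
Proof.
rewrite /escape -cardfsUI; apply: leq_trans (leq_addr _ _).
apply: fsubset_leq_card; apply/fsubsetP => x; rewrite !inE /=.
by rewrite negb_or => /andP[/orP[->|->] /andP[-> ->]]; rewrite ?orbT.
Qed.

Lemma escape_card k A B : (#|` [fset a in A | (k + a)%R \in B]%fset| <= #|` B|)%N.
Proof.
rewrite -(card_ftranslate (- k) B); apply: fsubset_leq_card.
apply/fsubsetP => x; rewrite !inE mem_ftranslate opprK addrC.
by case/andP => _; rewrite addrC.
Qed.

(** As many points enter a finite set under a translation as leave it, so
    deleting [B] from [A] costs no more than the leaks of both. *)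
Lemma escapeD k A B : (escape k (A `\` B)%fset <= escape k A + escape k B)%N.
Proof.
have e1 : (#|` ftranslate (- k) B `\` B|%fset <= escape k B)%N.
  have -> : escape k B = (#|` B| - #|` ftranslate (- k) B `&` B|%fset)%N.
    rewrite fsetIC -cardfsD /escape; congr (#|` _|); apply/fsetP => x.
    by rewrite !inE mem_ftranslate opprK addrC andbC addrC.
  by rewrite cardfsD card_ftranslate.
apply: leq_trans (leq_add (leqnn _) e1).
rewrite /escape -cardfsUI; apply: leq_trans (leq_addr _ _).
apply: fsubset_leq_card; apply/fsubsetP => x; rewrite !inE /=.
rewrite mem_ftranslate opprK (addrC x).
by case: (x \in B); case: (x \in A); case: (k + x \in A); case: (k + x \in B).
Qed.

Lemma leak_ftranslate K g A : leak K (ftranslate g A) = leak K A.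
Proof. by apply: eq_bigr => k _; rewrite escape_ftranslate. Qed.

Lemma leakU K A B : (leak K (A `|` B)%fset <= leak K A + leak K B)%N.
Proof. by rewrite /leak -big_split leq_sum // => k _; exact: escapeU. Qed.

Lemma leakD K A B : (leak K (A `\` B)%fset <= leak K A + leak K B)%N.
Proof. by rewrite /leak -big_split leq_sum // => k _; exact: escapeD. Qed.

(** Double counting of the pairs [(c, k)] with [k + c] in [V], over the
    centres [c] whose translate of [K] stays inside [U]. *)
Lemma crowded_translates K U V (m : nat) :
  (forall c, c \in U -> (forall k, k \in K -> (k + c)%R \in U) ->
     m <= #|` [fset k in K | (k + c)%R \in V]%fset|)%N ->
  (m * #|` U| <= #|` K| * #|` V| + m * leak K U)%N.
Proof.
move=> H.
pose good c := all (fun k => k + c \in U) K.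
have -> : leak K U = (\sum_(c <- U) \sum_(k <- K) ((k + c)%R \notin U))%N.
  rewrite /leak exchange_big; apply: eq_bigr => k _ /=.
  exact: card_fset_sep.
rewrite card_fset_sum1 !big_distrr /=.
suff L : (\sum_(c <- U) \sum_(k <- K) ((k + c)%R \in V) <= #|` K| * #|` V|)%N.
  apply: leq_trans (leq_add L (leqnn _)).
  rewrite -big_split /=; rewrite big_seq [leqRHS]big_seq.
  apply: leq_sum => c cU /=.
  have [gc|/allPn[k kK nk]] := boolP (good c).
    rewrite muln1; apply: leq_trans (leq_addr _ _).
    by rewrite -card_fset_sep; apply: H => // k kK; exact: (allP gc).
  rewrite muln1; apply: leq_trans (leq_addl _ _).
  rewrite leq_pmulr // (big_rem k) //= nk //.
rewrite exchange_big /= card_fset_sum1 big_distrl /=.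
apply: leq_sum => k _; rewrite mul1n -card_fset_sep; exact: escape_card.
Qed.

End Leaks.

(** * The Ornstein-Weiss lemma *)

Section OrnsteinWeiss.
Context (R : realType) (G : zmodType) (phi : {fset G} -> R) (C : R).
Hypothesis phiU : forall A B, phi (A `|` B)%fset <= phi A + phi B.
Hypothesis phiT : forall g A, phi (ftranslate g A) <= phi A.
Hypothesis phi_ge0 : forall A, 0 <= phi A.
Hypothesis phi_card : forall A, phi A <= C * (#|` A|)%:R.
Implicit Types (A B K U V : {fset G}) (Ks : seq {fset G}).

(** What the covering argument remembers of a union of almost disjoint tiles:
    its [phi] and its leaks are linear in its size. *)
Definition admissible (a b : R) Ks A (V : {fset G}) : Prop :=
  [/\ (V `<=` A)%fset, phi V <= a * (#|` V|)%:R
    & forall K, K \in Ks -> (leak K V)%:R <= b * (#|` V|)%:R].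

(** The tile shapes of a quasi-tiling, largest first; each one is almost
    invariant under all the smaller ones. *)
Fixpoint tower (s eta : R) Ks : Prop :=
  if Ks is K :: Ks' then
    [/\ K != fset0, phi K <= s * (#|` K|)%:R,
        forall K', K' \in Ks' -> (leak K' K)%:R <= eta * (#|` K|)%:R
      & tower s eta Ks']
  else True.

(** A tile that overlaps [V] in at most a proportion [t] of its size brings at
    least [(1 - t) * #|K|] new points, which pay for [phi K] and for its leaks
    at the rates [s / (1 - t)] and [eta / (1 - t)]. *)
Lemma admissible_add s eta t K Ks A V c :
  0 <= s -> 0 <= eta -> 0 < t < 1 ->
  tower s eta (K :: Ks) -> admissible (s / (1 - t)) (eta / (1 - t)) Ks A V ->
  (ftranslate c K `<=` A)%fset ->
  (#|` V `&` ftranslate c K|%fset)%:R <= t * (#|` K|)%:R ->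
  admissible (s / (1 - t)) (eta / (1 - t)) Ks A (V `|` ftranslate c K)%fset /\
  (#|` V| < #|` V `|` ftranslate c K|%fset)%N.
Proof.
move=> s0 e0 /andP[t0 t1] [K0 phiK leakK _] [VA phiV leakV] KA small.
have t1' : 0 < 1 - t by lra.
have kpos : (0 : R) < (#|` K|)%:R by rewrite ltr0n cardfs_gt0.
have cardE : (#|` V `|` ftranslate c K|%fset)%:R =
    (#|` V|)%:R + (#|` K|)%:R - (#|` V `&` ftranslate c K|%fset)%:R :> R.
  have := cardfsUI V (ftranslate c K); rewrite card_ftranslate.
  move=> /(congr1 (fun n => n%:R : R)); rewrite !natrD; lra.
have grow : (#|` V|)%:R + (1 - t) * (#|` K|)%:R
    <= (#|` V `|` ftranslate c K|%fset)%:R :> R by rewrite cardE; lra.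
have scale (d : R) : 0 <= d -> d / (1 - t) * (#|` V|)%:R + d * (#|` K|)%:R
    <= d / (1 - t) * (#|` V `|` ftranslate c K|%fset)%:R.
  move=> d0; have q0 : 0 <= d / (1 - t) by rewrite divr_ge0 // ltW.
  apply: le_trans (ler_wpM2l q0 grow).
  by rewrite mulrDr mulrA divfK // gt_eqF.
split; first split.
- by rewrite fsubUset VA KA.
- apply: le_trans (scale _ s0); apply: le_trans (phiU _ _) _.
  by apply: lerD => //; exact: le_trans (phiT _ _) phiK.
- move=> K' K'in; apply: le_trans (scale _ e0).
  apply: (@le_trans _ _ ((leak K' V)%:R + (leak K' K)%:R)).
    by rewrite -natrD ler_nat -(leak_ftranslate K' c K) leakU.
  by apply: lerD; [exact: leakV | exact: leakK].
- rewrite -(ltr_nat R); apply: lt_le_trans grow.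
  by rewrite ltrDl mulr_gt0.
Qed.

(** A covered set of maximal size is met by every translate of [K] lying in
    the part [A `\` V] not covered before in at least a proportion [t]:
    otherwise that translate could be added. Hence this stage covers a
    proportion [t] of [A `\` V], up to the leaks. *)
Lemma tower_stage s eta t K Ks A V :
  0 <= s -> 0 <= eta -> 0 < t < 1 ->
  tower s eta (K :: Ks) ->
  (leak K A)%:R <= eta * (#|` A|)%:R ->
  admissible (s / (1 - t)) (eta / (1 - t)) (K :: Ks) A V ->
  exists2 V', admissible (s / (1 - t)) (eta / (1 - t)) Ks A V' &
    (#|` A `\` V'|%fset)%:R <= (1 - t) * (#|` A `\` V|%fset)%:R
      + t * (eta + eta / (1 - t)) * (#|` A|)%:R.
Proof.
move=> s0 e0 t01 tow leakA admV.
have [VA phiV leakV] := admV.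
have /andP[t0 t1] := t01.
pose P n := exists V', [/\ (V `<=` V')%fset,
  admissible (s / (1 - t)) (eta / (1 - t)) Ks A V' & #|` V'| = n].
have exP : exists n, `[< P n >].
  exists #|` V|; apply/asboolP; exists V; split => //; split => // K' K'in.
  by apply: leakV; rewrite inE K'in orbT.
have ubP n : `[< P n >] -> (n <= #|` A|)%N.
  by move=> /asboolP[V' [_ [V'A _ _] <-]]; exact: fsubset_leq_card.
case: (ex_maxnP exP ubP) => n /asboolP[V' [VV' admV' V'n]] nmax.
exists V' => //.
have [V'A _ _] := admV'.
set U := (A `\` V)%fset.
have [K0 _ _ _] := tow.
have kpos : (0 : R) < (#|` K|)%:R by rewrite ltr0n cardfs_gt0.
pose m := (Num.truncn (t * (#|` K|)%:R)).+1.
have crowded c : c \in U -> (forall k, k \in K -> k + c \in U) ->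
    (m <= #|` [fset k in K | (k + c)%R \in (V' `\` V)%fset]%fset|)%N.
  move=> cU Kc; rewrite /m.
  have E : #|` [fset k in K | (k + c)%R \in (V' `\` V)%fset]%fset| =
           #|` V' `&` ftranslate c K|%fset.
    rewrite -(card_ftranslate c); congr (#|` _|); apply/fsetP => x.
    rewrite inE !mem_ftranslate !inE /= subrK.
    have [xK|] := boolP (x - c \in K); last by rewrite andbF.
    by have := Kc _ xK; rewrite subrK !inE => /andP[->]; rewrite andbT.
  rewrite E ltnNge; apply/negP => small.
  have small' : (#|` V' `&` ftranslate c K|%fset)%:R <= t * (#|` K|)%:R.
    rewrite -(ler_nat R) in small; apply: le_trans small _.
    by rewrite truncn_le // mulr_ge0 // ltW.
  have KA : (ftranslate c K `<=` A)%fset.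
    apply/fsubsetP => x; rewrite mem_ftranslate => /Kc.
    by rewrite subrK !inE => /andP[].
  have [admW] := admissible_add s0 e0 t01 tow admV' KA small'.
  rewrite V'n ltnNge => /negP; apply; apply: nmax; apply/asboolP.
  exists (V' `|` ftranslate c K)%fset; split => //.
  by apply: fsubset_trans VV' _; exact: fsubsetUl.
have := crowded_translates crowded.
rewrite -(ler_nat R) natrD !natrM => dc.
have mt : t * (#|` K|)%:R <= m%:R by apply/ltW; rewrite /m truncnS_gt.
have cardV' : (#|` V' `\` V|%fset)%:R = (#|` U|)%:R - (#|` A `\` V'|%fset)%:R :> R.
  have c1 := fsubset_leq_card VV'; have c2 := fsubset_leq_card V'A.
  rewrite /U !cardfsDS // !natrB ?(leq_trans c1) //; ring.
have leakU' : (leak K U)%:R <= (eta + eta / (1 - t)) * (#|` A|)%:R :> R.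
  apply: (@le_trans _ _ ((leak K A)%:R + (leak K V)%:R)).
    by rewrite -natrD ler_nat leakD.
  rewrite mulrDl lerD //; apply: le_trans (leakV K _) _; rewrite ?mem_head //.
  rewrite ler_wpM2l ?divr_ge0 ?subr_ge0 ?(ltW t1) //.
  by rewrite ler_nat fsubset_leq_card.
move: dc leakU' mt kpos; rewrite cardV'.
set x := (#|` U|)%:R; set y := (#|` A `\` V'|%fset)%:R; set l := (leak K U)%:R.
set q := (#|` K|)%:R; set r := m%:R; set w := (#|` A|)%:R.
move=> dc leakU' mt kpos.
have y_le : y <= x by have := ler0n R #|` V' `\` V|%fset; rewrite cardV'; rewrite -/x -/y; lra.
suff : t * (x - l) <= x - y.
  have : t * l <= t * ((eta + eta / (1 - t)) * w) by rewrite ler_pM2l.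
  lra.
have [xl|xl] := lerP (x - l) 0.
  have : t * (x - l) <= 0 by rewrite mulr_ge0_le0 // ltW.
  lra.
rewrite -(ler_pM2l kpos).
have : t * q * (x - l) <= r * (x - l) by rewrite ler_pM2r.
lra.
Qed.

(** Up to the leaks [d], each stage multiplies the size of the part that is not
    covered by [1 - t]. *)
Lemma tower_cover s eta t Ks A V :
  0 <= s -> 0 <= eta -> 0 < t < 1 -> tower s eta Ks ->
  (forall K, K \in Ks -> (leak K A)%:R <= eta * (#|` A|)%:R) ->
  admissible (s / (1 - t)) (eta / (1 - t)) Ks A V ->
  let d := (eta + eta / (1 - t)) * (#|` A|)%:R in
  exists2 V', admissible (s / (1 - t)) (eta / (1 - t)) [::] A V' &
    (#|` A `\` V'|%fset)%:R - d
      <= (1 - t) ^+ size Ks * ((#|` A `\` V|%fset)%:R - d).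
Proof.
move=> s0 e0 t01 tow leakA admV d.
have /andP[t0 t1] := t01.
elim: Ks V tow leakA admV => [|K Ks IH] V tow leakA admV.
  by exists V => //; rewrite expr0 mul1r.
have [V1 adm1 V1small] := tower_stage s0 e0 t01 tow (leakA _ (mem_head _ _)) admV.
have [_ _ _ tow'] := tow.
have [|V2 adm2 V2small] := IH V1 tow' _ adm1.
  by move=> K' K'in; apply: leakA; rewrite inE K'in orbT.
exists V2 => //; apply: le_trans V2small _ => /=.
rewrite exprSr -mulrA ler_wpM2l ?exprn_ge0 ?subr_ge0 ?(ltW t1) //.
move: V1small; rewrite -mulrA -/d; lra.
Qed.

Lemma tower_bound s eta t Ks A :
  0 <= s -> 0 <= eta -> 0 < t < 1 -> tower s eta Ks ->
  (forall K, K \in Ks -> (leak K A)%:R <= eta * (#|` A|)%:R) ->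
  0 <= C ->
  phi A <= (s / (1 - t) + C * ((1 - t) ^+ size Ks + (eta + eta / (1 - t))))
           * (#|` A|)%:R.
Proof.
move=> s0 e0 t01 tow leakA C0; have /andP[t0 t1] := t01.
have a0 : 0 <= s / (1 - t) by rewrite divr_ge0 // subr_ge0 ltW.
have [|] := tower_cover s0 e0 t01 tow leakA (V := fset0%fset).
  split; first exact: fsub0set.
    by rewrite cardfs0 mulr0; have := phi_card fset0; rewrite cardfs0 mulr0.
  move=> K _; rewrite cardfs0 mulr0 /leak big1 // => k _; apply/eqP.
  by rewrite cardfs_eq0; apply/eqP/fsetP => x; rewrite !inE.
move=> V [VA phiV _]; rewrite fsetD0; set d := _ * _ => small.
have p0 : 0 <= (1 - t) ^+ size Ks by rewrite exprn_ge0 // subr_ge0 ltW.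
have d0 : 0 <= d by rewrite mulr_ge0 // addr_ge0 // divr_ge0 // subr_ge0 ltW.
have -> : A = (V `|` (A `\` V))%fset by rewrite fsetUDl fsetDv fsetD0; apply/esym/fsetUidPr.
apply: le_trans (phiU _ _) _.
rewrite (_ : (V `|` (A `\` V))%fset = A); last first.
  by rewrite fsetUDl fsetDv fsetD0; apply/fsetUidPr.
rewrite mulrDl; apply: lerD.
  apply: le_trans phiV _; rewrite ler_wpM2l // ler_nat; exact: fsubset_leq_card.
apply: le_trans (phi_card _) _; rewrite -mulrA ler_wpM2l // mulrDl -/d.
have : 0 <= (1 - t) ^+ size Ks * d by rewrite mulr_ge0.
move: small; rewrite mulrBr; lra.
Qed.

Section Folner.
Variable F : nat -> {fset G}.
Hypothesis folnerF : is_folner R F.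

Let F_gt0 n : (0 : R) < (#|` F n|)%:R.
Proof. by case: folnerF => F0 _; rewrite ltr0n cardfs_gt0; apply/eqP. Qed.

Lemma folner_escape k :
  (escape k (F n))%:R / (#|` F n|)%:R @[n --> \oo] --> (0 : R).
Proof.
case: folnerF => _ /(_ k) cv.
apply: (squeeze_cvgr _ (cvg_cst (0:R)) cv).
apply: nearW => n; rewrite divr_ge0 //= ler_wpM2r ?invr_ge0 // ler_nat.
rewrite /escape -(card_ftranslate k [fset a in F n | (k + a)%R \notin F n]%fset).
rewrite /fsymdiff; apply: fsubset_leq_card.
apply/fsubsetP => x; rewrite !inE !mem_ftranslate !inE /=.
by rewrite (addrC k) subrK => /andP[-> ->].
Qed.

Lemma folner_leak K (eta : R) : 0 < eta ->
  \forall n \near \oo, (leak K (F n))%:R <= eta * (#|` F n|)%:R.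
Proof.
move=> e0.
have cv (ks : seq G) : (\sum_(k <- ks) escape k (F n))%N%:R / (#|` F n|)%:R
    @[n --> \oo] --> (0 : R).
  elim: ks => [|k ks IH].
    by under eq_fun do rewrite big_nil mul0r; exact: cvg_cst.
  under eq_fun do rewrite big_cons natrD mulrDl.
  by rewrite -[(0 : R)]addr0; apply: cvgD; [exact: folner_escape | exact: IH].
near=> n; rewrite -ler_pdivrMr //.
have : `|0 - (leak K (F n))%:R / (#|` F n|)%:R| < eta.
  by near: n; move/cvgrPdist_lt: (cv K); exact.
by rewrite sub0r normrN ger0_norm ?divr_ge0 // => /ltW.
Unshelve. all: by end_near.
Qed.

Lemma folner_leaks Ks (eta : R) : 0 < eta ->
  \forall n \near \oo, forall K, K \in Ks ->
    (leak K (F n))%:R <= eta * (#|` F n|)%:R.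
Proof.
move=> e0; elim: Ks => [|K Ks IH]; first by apply: nearW.
near=> n; move=> K'; rewrite inE => /orP[/eqP ->|].
  by near: n; exact: folner_leak.
by move: K'; near: n.
Unshelve. all: by end_near.
Qed.

Lemma exists_tower (s eta : R) k : 0 < eta ->
  (forall N, exists2 n, (N <= n)%N & phi (F n) <= s * (#|` F n|)%:R) ->
  exists2 Ks, size Ks = k & tower s eta Ks.
Proof.
move=> e0 often; elim: k => [|k [Ks sKs tow]]; first by exists [::].
have [N _ HN] := folner_leaks Ks e0.
have [n Nn phin] := often N.
exists (F n :: Ks); first by rewrite /= sKs.
split => //; first by case: folnerF => F0 _; apply/eqP.
exact: HN.
Qed.

(** A tower is made of sets [F n] with a low average. A much later set [F n] is
    almost tiled by them, and the rest of it costs little by [phi_card]. *)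
Lemma average_lt_eventually (s e : R) : 0 <= s -> 0 <= C -> 0 < e ->
  (forall N, exists2 n, (N <= n)%N & phi (F n) <= s * (#|` F n|)%:R) ->
  \forall n \near \oo, phi (F n) / (#|` F n|)%:R <= s + e.
Proof.
move=> s0 C0 e0 often.
(* [t] makes the overlap loss [s / (1 - t) - s] at most [e / 2]. *)
pose t : R := e / (2 * (s + e)).
have se : 0 < s + e by lra.
have t0 : 0 < t by rewrite divr_gt0 // mulr_gt0.
have t1 : t <= 1 / 2.
  by rewrite /t ler_pdivrMr ?mulr_gt0 //; lra.
have st : s / (1 - t) <= s + e / 2.
  rewrite ler_pdivrMr; last lra.
  have tse : t * (2 * (s + e)) = e by rewrite /t divfK // gt_eqF // mulr_gt0.
  have te : t * e <= e / 2 by rewrite mulrC -{2}[e]mulr1 -mulrA ler_pM2l //; lra.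
  nra.
pose d : R := e / (4 * (C + 1)).
have d0 : 0 < d by rewrite divr_gt0 // mulr_gt0 //; lra.
have Cd : C * (2 * d) <= e / 2.
  have : d * (4 * (C + 1)) = e by rewrite /d divfK // gt_eqF // mulr_gt0 //; lra.
  lra.
have [k _ /(_ k (leqnn k)) hk] : \forall k \near \oo, `|0 - (1 - t) ^+ k| < d.
  have cv : (1 - t) ^+ n @[n --> \oo] --> (0 : R).
    by apply: cvg_expr; rewrite ger0_norm; lra.
  by move/cvgrPdist_lt: cv; exact.
have {}hk : (1 - t) ^+ k <= d.
  by move: hk; rewrite sub0r normrN ger0_norm ?exprn_ge0 //; lra.
pose eta : R := d / 3.
have eta0 : 0 < eta by rewrite divr_gt0.
have eta_small : eta + eta / (1 - t) <= d.
  have : eta / (1 - t) <= 2 * eta.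
    rewrite ler_pdivrMr; last lra.
    have : eta * t <= eta * (1 / 2) by rewrite ler_pM2l.
    lra.
  rewrite /eta; lra.
have [Ks sKs tow] := exists_tower k eta0 often.
near=> n.
rewrite ler_pdivrMr //.
have leakF : forall K, K \in Ks -> (leak K (F n))%:R <= eta * (#|` F n|)%:R.
  by near: n; exact: folner_leaks.
have t01 : 0 < t < 1 by lra.
apply: le_trans (tower_bound s0 (ltW eta0) t01 tow leakF C0) _.
rewrite ler_pM2r // sKs.
have : C * ((1 - t) ^+ k + (eta + eta / (1 - t))) <= C * (2 * d).
  by rewrite ler_wpM2l //; lra.
lra.
Unshelve. all: by end_near.
Qed.

(** The limit is the supremum of the eventual lower bounds of the averages. *)
Theorem ornstein_weiss : 0 <= C -> cvgn (fun n => phi (F n) / (#|` F n|)%:R).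
Proof.
move=> C0.
pose r n := phi (F n) / (#|` F n|)%:R.
have r0 n : 0 <= r n by rewrite divr_ge0.
have rC n : r n <= C by rewrite ler_pdivrMr.
pose E : set R := [set s | \forall n \near \oo, s <= r n].
have E0 : E 0 by apply: nearW.
have Eub : ubound E C.
  by move=> s [N _ /(_ N (leqnn N)) h]; exact: le_trans h (rC N).
have supE : has_sup E by split; [exists 0|exists C].
have l0 : 0 <= sup E by apply: ub_le_sup => //; exists C.
apply: (cvgP (sup E)); apply/cvgrPdist_le => e e0.
have e2 : 0 < e / 2 by rewrite divr_gt0.
have [s Es ss] := sup_adherent e2 supE.
have often N : exists2 n, (N <= n)%N & phi (F n) <= (sup E + e / 2) * (#|` F n|)%:R.
  apply: contrapT => H.
  have : E (sup E + e / 2).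
    exists N => // n Nn /=; rewrite leNgt; apply/negP => lt; apply: H.
    by exists n => //; rewrite -ler_pdivrMr // ltW.
  by move/(ub_le_sup supE.2); lra.
have up : \forall n \near \oo, r n <= sup E + e / 2 + e / 2.
  by apply: average_lt_eventually => //; lra.
near=> n.
have h1 : r n <= sup E + e / 2 + e / 2 by near: n.
have h2 : s <= r n by near: n.
rewrite ler_norml; apply/andP; split; rewrite -/(r n); lra.
Unshelve. all: by end_near.
Qed.

End Folner.
End OrnsteinWeiss.

(** * Counting itineraries through a two-set cover *)

Section Covers.
Context (G : zmodType) (X : topologicalType) (T : G -> X -> X) (x0 : X).
Hypothesis T0 : forall x, T 0 x = x.
Hypothesis TD : forall g h x, T (g + h) x = T g (T h x).
Variable W : bool -> set X.
Hypothesis W_cover : forall x, W true x \/ W false x.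
Implicit Types (F J : {fset G}).

(** A subcover of the join, seen as a list of [k] words that choose a cover
    element at every [g]. *)
Definition itineraries F (k : nat) (c : nat -> G -> bool) : Prop :=
  forall x, exists2 i, (i < k)%N & forall g, g \in F -> W (c i g) (T g x).

Definition ncover F : nat :=
  cover_number (cover_join F
    (fun g => cover_image T (- g) [set W true; W false])).

Let join F := cover_join F (fun g => cover_image T (- g) [set W true; W false]).

Definition cylinder F (c : G -> bool) : set X :=
  \bigcap_(g in [set` F]) (T (- g) @` W (c g)).

Lemma cylinderP F c x :
  cylinder F c x <-> forall g, g \in F -> W (c g) (T g x).
Proof.
split=> H g gF.
  by have [y Wy <-] := H g gF; rewrite -TD addrN T0.
by exists (T g x); [exact: H | rewrite -TD addNr T0].
Qed.

Lemma join_cylinder F c : join F (cylinder F c).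
Proof.
exists (fun g => T (- g) @` W (c g)) => // g gF.
by exists (W (c g)) => //; case: (c g); [left | right].
Qed.

Lemma join_is_cylinder F V : join F V -> exists c, V = cylinder F c.
Proof.
move=> [w Hw <-].
have [b Hb] : {b : G -> bool & forall g, g \in F -> w g = T (- g) @` W (b g)}.
  apply: (@choice _ _ (fun g b => g \in F -> w g = T (- g) @` W b)) => g.
  have [gF|] := boolP (g \in F); last by exists true.
  by have [V' [|] -> <-] := Hw g gF; [exists true | exists false].
by exists b; apply: eq_bigcapr => g gF; exact: Hb.
Qed.

Lemma subcover_of_itineraries F k c : itineraries F k c ->
  exists2 j, (j <= k)%N & subcover_card (join F) j.
Proof.
move=> H; pose f i := cylinder F (c i); pose S := f @` `I_k.
have finS : finite_set S by apply: finite_image; exact: finite_II.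
have /finite_setP[j Sj] := finS.
exists j.
  rewrite -card_le_II; apply: card_le_trans (card_image_le f `I_k).
  by move: Sj; rewrite card_eq_le => /andP[].
exists S; split => //.
- by move=> V [i _ <-]; exact: join_cylinder.
- apply/seteqP; split=> // x _; have [i ik Hi] := H x.
  by exists (f i); [exists i | apply/cylinderP].
Qed.

Lemma itineraries_of_subcover F k : subcover_card (join F) k ->
  exists c, itineraries F k c.
Proof.
move=> [S [SU Scov Sk]].
move: Sk; rewrite card_eq_sym => /card_set_bijP[f [fS _ fsurj]].
have [c Hc] : {c : nat -> G -> bool & forall i, (i < k)%N -> f i = cylinder F (c i)}.
  apply: (@choice _ _ (fun i c => (i < k)%N -> f i = cylinder F c)) => i.
  have [ik|] := boolP (i < k)%N; last by exists (fun=> true).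
  by have [c ->] := join_is_cylinder (SU _ (fS i ik)); exists c.
exists c => x.
have : (\bigcup_(V in S) V) x by rewrite Scov.
move=> [V /fsurj[i ik <-]]; rewrite (Hc i ik) => /cylinderP h.
by exists i.
Qed.

Lemma itineraries0 : itineraries fset0 1 (fun _ _ => true).
Proof. by move=> x; exists 0%N => // g; rewrite inE. Qed.

Lemma itinerariesU A B k l c d : itineraries A k c -> itineraries B l d ->
  itineraries (A `|` B)%fset (k * l)
    (fun i g => if g \in A then c (i %/ l)%N g else d (i %% l)%N g).
Proof.
move=> Hc Hd x; have [i ik Hi] := Hc x; have [j jl Hj] := Hd x.
have l0 : (0 < l)%N by exact: leq_ltn_trans jl.
exists (i * l + j)%N.
  apply: (@leq_trans (i.+1 * l)); first by rewrite mulSn addnC ltn_add2r.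
  by rewrite leq_pmul2r.
move=> g; rewrite inE divnMDl // divn_small // addn0 modnMDl modn_small //.
by case: ifP => [gA _|_ /= gB]; [exact: Hi | exact: Hj].
Qed.

Lemma itineraries_translate a F k c : itineraries F k c ->
  itineraries (ftranslate a F) k (fun i g => c i (g - a)).
Proof.
move=> H x; have [i ik Hi] := H (T a x); exists i => // g.
by rewrite mem_ftranslate => /Hi; rewrite -TD subrK.
Qed.

Lemma itineraries_card F : exists c, itineraries F (2 ^ #|` F|) c.
Proof.
elim/fset1U_rect: F => [|g F gF [c Hc]].
  by exists (fun _ _ => true); rewrite cardfs0; exact: itineraries0.
pose d (i : nat) (g : G) := i == 1%N.
have Hd : itineraries [fset g]%fset 2 d.
  move=> x; case: (W_cover (T g x)) => Wx.
    by exists 1%N => // h; rewrite inE => /eqP ->.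
  by exists 0%N => // h; rewrite inE => /eqP ->.
rewrite cardfsU1 gF expnS.
by eexists; exact: itinerariesU Hd Hc.
Qed.

Lemma ncoverP F : subcover_card (join F) (ncover F) /\
  forall j, subcover_card (join F) j -> (ncover F <= j)%N.
Proof.
apply: (@xgetPex _ 0%N [set k | subcover_card (join F) k /\
  forall j, subcover_card (join F) j -> (k <= j)%N]).
have [c Hc] := itineraries_card F.
have [j _ Hj] := subcover_of_itineraries Hc.
have ex : exists j, `[< subcover_card (join F) j >] by exists j; apply/asboolP.
case: (ex_minnP ex) => m /asboolP Hm mmin; exists m; split => // i Hi.
by apply: mmin; apply/asboolP.
Qed.

Lemma ncover_le F k c : itineraries F k c -> (ncover F <= k)%N.
Proof.
move=> /subcover_of_itineraries[j jk Hj].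
exact: leq_trans ((ncoverP F).2 _ Hj) jk.
Qed.

Lemma ncover_itineraries F : exists c, itineraries F (ncover F) c.
Proof. exact: itineraries_of_subcover (ncoverP F).1. Qed.

Lemma ncover_gt0 F : (0 < ncover F)%N.
Proof.
by have [c /(_ x0)[i ik _]] := ncover_itineraries F; exact: leq_ltn_trans ik.
Qed.

(** A choice of cover elements that avoids [W (w g)] at every [g] of [J] is
    determined on [J] by [w], so each cylinder serves one of the [2 ^ #|J|]
    words [w]. *)
Lemma ncover_independent F J : (J `<=` F)%fset ->
  (forall w : G -> bool, exists x, forall g, g \in J -> ~ W (w g) (T g x)) ->
  (2 ^ #|` J| <= ncover F)%N.
Proof.
move=> JF ind; have [c Hc] := ncover_itineraries F.
pose P (w : {ffun J -> bool}) (i : 'I_(ncover F)) :=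
  forall g : J, c i (val g) = ~~ w g.
have exP w : exists i, P w i.
  have [x Hx] := ind (fun g => if insub g is Some h then w h else true).
  have [i iN Hi] := Hc x; exists (Ordinal iN) => g /=.
  have := Hx (val g) (valP g); rewrite valK.
  have := Hi (val g) (fsubsetP JF _ (valP g)).
  by case: (c i (val g)); case: (w g).
have [f Hf] := choice exP.
have : injective f.
  move=> w w' e; apply/ffunP => g; apply: negb_inj; by rewrite -!Hf e.
move/leq_card; rewrite card_ord card_ffun card_bool cardfE //.
Qed.

(** If the cover element to choose at [g] depends on [pi g] only, then the words
    on the image of [F] are enough. *)
Lemma itineraries_factor (K : choiceType) (pi : G -> K) F :
  (forall x, exists w : K -> bool, forall g, g \in F -> W (w (pi g)) (T g x)) ->
  exists c, itineraries F (2 ^ #|` [fset pi g | g in F]%fset|) c.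
Proof.
move=> H; set D := [fset pi g | g in F]%fset.
pose w0 : {ffun D -> bool} := [ffun=> true].
exists (fun i g => if insub (pi g) is Some d
                   then nth w0 (enum {ffun D -> bool}) i d else true).
move=> x; have [w Hw] := H x; pose w' : {ffun D -> bool} := [ffun d => w (val d)].
have w'in : w' \in enum {ffun D -> bool} by rewrite mem_enum.
exists (index w' (enum {ffun D -> bool})).
  by rewrite cardfE -card_bool -card_ffun cardE index_mem.
move=> g gF; rewrite nth_index //.
have gD : pi g \in D by apply: in_imfset.
by rewrite insubT ffunE; exact: Hw.
Qed.

Section Entropy.
Context (R : realType).

Definition hcover F : R := ln (ncover F)%:R.

Lemma hcover_ge0 F : 0 <= hcover F.
Proof. by rewrite ln_ge0 // ler1n ncover_gt0. Qed.

Lemma hcover_le F (k : nat) : (ncover F <= k)%N -> hcover F <= ln k%:R.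
Proof.
move=> Nk; rewrite ler_ln ?ler_nat // posrE ltr0n ?ncover_gt0 //.
exact: leq_trans (ncover_gt0 F) Nk.
Qed.

Lemma hcoverU A B : hcover (A `|` B)%fset <= hcover A + hcover B.
Proof.
have [c Hc] := ncover_itineraries A; have [d Hd] := ncover_itineraries B.
apply: le_trans (hcover_le (ncover_le (itinerariesU Hc Hd))) _.
by rewrite natrM lnM // posrE ltr0n ncover_gt0.
Qed.

Lemma hcover_translate g A : hcover (ftranslate g A) <= hcover A.
Proof.
have [c Hc] := ncover_itineraries A.
exact: hcover_le (ncover_le (itineraries_translate g Hc)).
Qed.

Lemma hcover_card A : hcover A <= ln 2 * (#|` A|)%:R.
Proof.
have [c Hc] := itineraries_card A.
apply: le_trans (hcover_le (ncover_le Hc)) _.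
by rewrite natrX lnXn // mulr_natr.
Qed.

Variable F : nat -> {fset G}.
Hypothesis folnerF : is_folner R F.

Let F_gt0 n : (0 : R) < (#|` F n|)%:R.
Proof. by case: folnerF => F0 _; rewrite ltr0n cardfs_gt0; apply/eqP. Qed.

Let htopF := htop R T F [set W true; W false].

Lemma htop_cvg : hcover (F n) / (#|` F n|)%:R @[n --> \oo] --> htopF.
Proof.
have := @ornstein_weiss R G hcover (ln 2) hcoverU hcover_translate
  hcover_ge0 hcover_card F folnerF.
by apply; rewrite ln_ge0 // ler1n.
Qed.

(** A proportion [1 / m] of independent times bounds the entropy of the cover
    below by [ln 2 / m]. *)
Lemma htop_gt0_independent (m : nat) : (0 < m)%N ->
  (forall n, exists2 J, (J `<=` F n)%fset &
     (#|` F n| <= m * #|` J|)%N /\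
     forall w : G -> bool, exists x, forall g, g \in J -> ~ W (w g) (T g x)) ->
  0 < htopF.
Proof.
move=> m0 H; have l2 : (0 : R) < ln 2 by rewrite ln_gt0 // ltr1n.
apply: (@lt_le_trans _ _ (ln 2 / m%:R)); first by rewrite divr_gt0 // ltr0n.
have cv : cvgn (fun n => hcover (F n) / (#|` F n|)%:R) by apply: cvgP htop_cvg.
apply: (limr_ge cv); apply: nearW => n.
have [J JF [Fm ind]] := H n.
rewrite ler_pdivlMr // mulrAC ler_pdivrMr ?ltr0n //.
apply: (@le_trans _ _ (ln 2 * (m * #|` J|)%:R)).
  by rewrite ler_pM2l // ler_nat.
rewrite natrM mulrCA mulrC ler_pM2r ?ltr0n //.
rewrite mulr_natr -lnXn // -natrX ler_ln ?posrE ?ltr0n ?ncover_gt0 ?expn_gt0 //.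
by rewrite ler_nat; exact: ncover_independent ind.
Qed.

Lemma htop_le0_slow (p : nat -> nat) :
  (p n)%:R / (#|` F n|)%:R @[n --> \oo] --> (0 : R) ->
  (forall n, exists c, itineraries (F n) (2 ^ p n) c) ->
  htopF = 0.
Proof.
move=> p0 H.
have lim0 : hcover (F n) / (#|` F n|)%:R @[n --> \oo] --> (0 : R).
  have cv : ln 2 * ((p n)%:R / (#|` F n|)%:R) @[n --> \oo] --> (0 : R).
    by rewrite -[(0:R)](mulr0 (ln 2)); exact: cvgMr.
  apply: (squeeze_cvgr _ (cvg_cst (0 : R)) cv).
  apply: nearW => n; rewrite divr_ge0 ?hcover_ge0 //= mulrA ler_wpM2r ?invr_ge0 //.
  have [c Hc] := H n.
  by apply: le_trans (hcover_le (ncover_le Hc)) _; rewrite natrX lnXn // mulr_natr.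
exact: (cvg_unique _ htop_cvg lim0).
Qed.

End Entropy.
End Covers.

(** * Subshifts given by a local rule *)

Section LocalShifts.
Context (G : zmodType) (A : finType).
Implicit Types (D : {fset G}) (x y : config G A).

Definition agree D x y : Prop := forall h, h \in D -> y h = x h.

Lemma agree_nbhs D x : nbhs x (agree D x).
Proof.
have E : agree D x = \bigcap_(h in [set` D]) [set y | y h = x h].
  by apply/seteqP; split.
have FF : Filter (nbhs x) by exact: nbhs_filter.
rewrite E; apply: filter_bigI => h _.
have c : {ptws, nbhs x --> x} by move=> V.
move/(@pointwise_cvgP (discrete_topology G) (discrete_topology A) (nbhs x) x FF): c.
by move=> /(_ h) /(_ [set x h]); apply; exact: discrete_set1.
Qed.

Lemma nbhs_agree x U : nbhs x U -> exists D, agree D x `<=` U.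
Proof.
pose Fx : set_system (config G A) := [set V | exists D, agree D x `<=` V].
have FF : Filter Fx.
  split; first by exists fset0.
    move=> P Q [D DP] [E EQ]; exists (D `|` E)%fset => y Hy; split.
      by apply: DP => h hD; apply: Hy; rewrite inE hD.
    by apply: EQ => h hD; apply: Hy; rewrite inE hD orbT.
  by move=> P Q PQ [D DP]; exists D; exact: subset_trans PQ.
have : {ptws, Fx --> x}.
  apply/(@pointwise_cvgP (discrete_topology G) (discrete_topology A) Fx x) => h V Vx.
  exists [fset h]%fset => y /(_ h) /=; rewrite inE eqxx => /(_ isT) e.
  by move: Vx; rewrite -e; exact: nbhs_singleton.
exact.
Qed.

Variables (W : {fset G}) (Q : (G -> A) -> Prop).
Hypothesis Qlocal : forall x y : G -> A, (forall w, w \in W -> x w = y w) ->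
  Q x -> Q y.

Definition local_set : set (config G A) :=
  [set x | forall g, Q (fun h => x (g + h))].

Lemma local_set_closed : closed local_set.
Proof.
rewrite -[local_set]setCK; apply: open_closedC; rewrite openE => x.
move=> /existsNP[g nQ].
apply: (filterS _ (agree_nbhs (ftranslate g W) x)) => y Hy /(_ g) Qy.
apply: nQ; apply: Qlocal Qy => w wW; apply: Hy.
by rewrite mem_ftranslate addrC addKr.
Qed.

Lemma local_set_invariant g x : local_set x -> local_set (config_shift g x).
Proof.
move=> H h; apply: Qlocal (H (h - g)) => w _.
by rewrite /config_shift addrAC.
Qed.

Definition local_shift : subshift G A :=
  Subshift local_set_closed local_set_invariant.

Lemma local_shift_sft : is_sft local_shift.
Proof.
pose pat (f : {ffun W -> A}) : pattern G A := [fmap w : W => f w].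
pose bad (f : {ffun W -> A}) := `[< forall x : G -> A, (forall w : W, x (val w) = f w) -> ~ Q x >].
exists [seq pat f | f <- enum {ffun W -> A} & bad f].
apply/seteqP; split=> x.
  move=> Hx p /mapP[f]; rewrite mem_filter => /andP[/asboolP fbad _] -> [g Hg].
  apply: (fbad _ _ (Hx g)) => w.
  by have := Hg w; rewrite ffunE.
move=> Hx g; apply: contrapT => nQ.
pose f : {ffun W -> A} := [ffun w : W => x (g + val w)].
apply: (Hx (pat f)).
  apply/mapP; exists f => //; rewrite mem_filter mem_enum andbT.
  apply/asboolP => y Hy Qy; apply: nQ; apply: Qlocal Qy => w wW.
  by have := Hy [` wW]%fset; rewrite ffunE.
by exists g => h; rewrite !ffunE.
Qed.

End LocalShifts.

Section SubshiftTopology.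
Context (G : zmodType) (A : finType) (X : subshift G A).
Implicit Types (x y : X) (D : {fset G}).

Lemma subshift_agree_nbhs D x :
  nbhs x [set y : X | agree D (val x) (val y)].
Proof.
have := @initial_continuous X (config G A) val x _ (agree_nbhs D (val x)).
exact.
Qed.

Lemma subshift_nbhs_agree x (U : set X) : nbhs x U ->
  exists D, forall y : X, agree D (val x) (val y) -> U y.
Proof.
move=> [_ [[B oB <-] Bx] BU].
have [D DB] := nbhs_agree (open_nbhs_nbhs (conj oB Bx)).
by exists D => y /DB /BU.
Qed.

Lemma subshift_act0 x : subshift_act 0 x = x.
Proof. by apply: val_inj; apply/funext => h /=; rewrite /config_shift subr0. Qed.

Lemma subshift_actD g h x :
  subshift_act (g + h) x = subshift_act g (subshift_act h x).
Proof.
apply: val_inj; apply/funext => k /=.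
by rewrite /config_shift opprD addrA.
Qed.

End SubshiftTopology.

(** * The third class *)

Section CpeClass3.
Context (R : realType) (G : zmodType) (X : topologicalType) (T : G -> X -> X).
Variable F : nat -> {fset G}.

Let E1 := cpe_rel R T F 1.

(** A pair fails to be an entropy pair because of two disjoint closed
    neighborhoods, and these serve all the nearby pairs as well. *)
Lemma closed_entropy_pairs : closed E1.
Proof.
rewrite -[E1]setCK; apply: open_closedC; rewrite openE => -[x y].
move=> /not_orP[/= nE nxy].
have [Ux [Uy [cx nx cy ny [dis nh]]]] : exists Ux Uy, [/\ closed Ux, nbhs x Ux,
    closed Uy, nbhs y Uy & Ux `&` Uy = set0 /\ ~ 0 < htop R T F [set ~` Ux; ~` Uy]].
  apply: contrapT => H; apply: nE; split => //= Ux Uy cx nx cy ny dis.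
  by apply: contrapT => nh; apply: H; exists Ux, Uy.
exists (Ux°, Uy°) => /=; first by split; exact: nbhs_interior.
move=> [x' y'] /= [ix iy]; apply/not_orP; split => /=.
  by move=> [_ /(_ Ux Uy cx ix cy iy dis)].
move=> e; rewrite -e in iy.
have : (Ux `&` Uy) x' by split; exact: interior_subset.
by rewrite dis.
Qed.

(** The second relation is dense and proper, hence not closed, so that the third
    one is its closure. *)
Lemma in_cpe_class3 :
  equiv_closure E1 <> setT -> closure (equiv_closure E1) = setT ->
  in_cpe_class R T F 3.
Proof.
move=> nT dense.
have c2 : cpe_rel R T F 2 = equiv_closure E1.
  by rewrite /= asboolT //; exact: closed_entropy_pairs.
have sub12 : E1 `<=` equiv_closure E1 by exact: sub_smallest.
split; last first.
  move=> [|[|[|//]]] // _; last by rewrite c2.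
  by move=> e; apply: nT; apply/seteqP; split => // p _; apply: sub12; rewrite /E1 e.
have -> : cpe_rel R T F 3 = if `[< closed (cpe_rel R T F 2) >]
    then equiv_closure (cpe_rel R T F 2) else closure (cpe_rel R T F 2) by [].
rewrite c2 asboolF // => /closure_id cl; apply: nT; rewrite cl.
exact: dense.
Qed.

End CpeClass3.

(** * Planes of sea and triangular islands *)

Section Planes.

Definition cell : finType := ('Z_7 * bool)%type.
Definition plane : Type := int -> int -> cell.

Implicit Types (a b c : 'Z_7) (p q : plane) (x y : int).

(** The modulus is 7 because [centered_shift] identifies integers that are known
    to be congruent and at distance at most 6. *)
Definition adj a b : bool := (b - a) \in [:: 0; 1; -1].

Definition hue p x y : 'Z_7 := (p x y).1.
Definition land p x y : bool := (p x y).2.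

(** The first two conditions make each island a triangle with its tip at the
    bottom: a row of land either disappears or grows by one cell at both
    ends, and a row of at least three cells stands on a row that is shorter by
    one cell at both ends. The last two make islands monochromatic. *)
Definition plane_rule p x y : Prop :=
  [/\ land p x y -> land p x (y + 1) ->
        land p (x + 1) (y + 1) /\ land p (x - 1) (y + 1),
      land p (x - 1) (y + 1) -> land p x (y + 1) -> land p (x + 1) (y + 1) ->
        land p x y,
      land p x y -> land p (x + 1) y -> hue p (x + 1) y = hue p x y
    & land p x y -> land p x (y + 1) -> hue p x (y + 1) = hue p x y].

(** The seas of two adjacent planes neither meet nor touch diagonally in the
    direction of [x]; otherwise [separated_le] would have no base case. *)
Definition stack_rule p q x y : Prop :=
  [/\ land p x y || land q (x - 1) y, land p x y || land q x y,
      land p x y || land q (x + 1) y & adj (hue p x y) (hue q x y)].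

Definition plane_ok p : Prop := forall x y, plane_rule p x y.
Definition stack_ok p q : Prop := forall x y, stack_rule p q x y.

Definition pure a : plane := fun _ _ => (a, true).

(** Points of the subshift, as sequences of planes indexed by height. *)
Definition stacked (f : int -> plane) : Prop :=
  forall z, plane_ok (f z) /\ stack_ok (f z) (f (z + 1)).

Lemma adj_refl a : adj a a.
Proof. by rewrite /adj subrr. Qed.

Lemma adj_sym a b : adj a b = adj b a.
Proof.
rewrite /adj !inE -(opprB b a) !eqr_oppLR oppr0 opprK.
by congr (_ || _); rewrite orbC.
Qed.

Section Separation.
Variables L M : int -> int -> bool.
Hypothesis expandL : forall x y, L x y -> L x (y + 1) ->
  L (x + 1) (y + 1) /\ L (x - 1) (y + 1).
Hypothesis expandM : forall x y, M x y -> M x (y + 1) ->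
  M (x + 1) (y + 1) /\ M (x - 1) (y + 1).
Hypothesis LM : forall x x' y, x <= x' -> x' <= x + 1 -> L x y || M x' y.

(** Between a hole of [L] and a hole of [M] at distance [d] on one row, the
    islands that fill the gap were narrower on the row below: there the holes
    are at distance [d - 2]. *)
Lemma separated_le (n : nat) x x' y :
  x <= x' -> x' <= x + n%:Z -> L x y || M x' y.
Proof.
elim/ltn_ind: n x x' y => n IH x x' y xx' xn.
have [near|far] := leP x' (x + 1); first exact: LM.
have n2 : (2 <= n)%N by lia.
have [//|Lx] := boolP (L x y); have [//|Mx] := boolP (M x' y).
have := IH n.-1 ltac:(lia) (x + 1) x' y ltac:(lia) ltac:(lia).
rewrite (negbTE Mx) orbF => L1.
have := IH n.-1 ltac:(lia) x (x' - 1) y ltac:(lia) ltac:(lia).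
rewrite (negbTE Lx) /= => M1.
have := IH (n - 2)%N ltac:(lia) (x + 1) (x' - 1) (y - 1) ltac:(lia) ltac:(lia).
case/orP => [L2|M2].
  have [] := expandL L2; rewrite !subrK // => _.
  by rewrite addrK (negbTE Lx).
have [] := expandM M2; rewrite !subrK //.
by rewrite (negbTE Mx).
Qed.

End Separation.

(** If the three cells above a sea cell were land, the cell would be land. *)
Lemma sea_climbs p x y (n : nat) : plane_ok p -> ~~ land p x y ->
  exists x', ~~ land p x' (y + n%:Z).
Proof.
move=> ok sea; elim: n => [|n [x' Hx']]; first by exists x; rewrite addr0.
have [_ /contra_not] := ok x' (y + n%:Z).
have -> : y + n.+1%:Z = y + n%:Z + 1 by lia.
move=> H _ _; apply: contrapT => /forallNP no.
have all x'' : land p x'' (y + n%:Z + 1) by apply/negPn/negP; exact: no.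
by have [_ /(_ (all _) (all _) (all _))] := ok x' (y + n%:Z); rewrite (negbTE Hx').
Qed.

(** Two seas climb to a common row, and there they are too close. *)
Lemma stack_full p q : plane_ok p -> plane_ok q -> stack_ok p q ->
  (forall x y, land p x y) \/ (forall x y, land q x y).
Proof.
move=> okp okq st; apply: contrapT => /not_orP[].
move=> /existsNP[x /existsNP[y /negP sp]] /existsNP[x' /existsNP[y' /negP sq]].
wlog [Y [X [X' [sp' sq']]]] : / exists Y X X', ~~ land p X Y /\ ~~ land q X' Y.
  apply; have [yy|yy] := leP y y'.
    have [X HX] := sea_climbs `|y' - y|%N okp sp.
    by exists y', X, x'; split => //; move: HX; congr (~~ land p _ _); lia.
  have [X HX] := sea_climbs `|y - y'|%N okq sq.
  by exists y, x, X; split => //; move: HX; congr (~~ land q _ _); lia.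
have ep x1 y1 : land p x1 y1 -> land p x1 (y1 + 1) ->
    land p (x1 + 1) (y1 + 1) /\ land p (x1 - 1) (y1 + 1) by have [] := okp x1 y1.
have eq x1 y1 : land q x1 y1 -> land q x1 (y1 + 1) ->
    land q (x1 + 1) (y1 + 1) /\ land q (x1 - 1) (y1 + 1) by have [] := okq x1 y1.
have pq x1 x2 y1 : x1 <= x2 -> x2 <= x1 + 1 -> land p x1 y1 || land q x2 y1.
  move=> h1 h2; have [_ h3 h4 _] := st x1 y1.
  have [->//|->//] : x2 = x1 \/ x2 = x1 + 1 by lia.
have qp x1 x2 y1 : x1 <= x2 -> x2 <= x1 + 1 -> land q x1 y1 || land p x2 y1.
  move=> h1 h2; have [h3 h4 _ _] := st x2 y1; rewrite orbC.
  have [->//|->//] : x1 = x2 \/ x1 = x2 - 1 by lia.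
have [XX|XX] := leP X X'.
  have := separated_le ep eq pq (n := `|X' - X|%N) Y XX ltac:(lia).
  by rewrite (negbTE sp') (negbTE sq').
have := separated_le eq ep qp (n := `|X' - X|%N) Y (ltW XX) ltac:(lia).
by rewrite (negbTE sp') (negbTE sq').
Qed.

Definition mid p : 'Z_7 := hue p 0 0.

Lemma full_pure p : plane_ok p -> (forall x y, land p x y) -> p = pure (mid p).
Proof.
move=> ok full.
have hx y x : hue p (x + 1) y = hue p x y by have [_ _ /(_ (full _ _) (full _ _))] := ok x y.
have hy x y : hue p x (y + 1) = hue p x y by have [_ _ _ /(_ (full _ _) (full _ _))] := ok x y.
have const (g : int -> 'Z_7) : (forall x, g (x + 1) = g x) -> forall x, g x = g 0.
  move=> H; elim=> [//|n IH|n IH].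
    by rewrite -IH -[in RHS]H; congr g; lia.
  by rewrite -IH -H; congr g; lia.
apply/funext => x; apply/funext => y; rewrite [LHS]surjective_pairing.
rewrite /pure; congr pair; last exact: full.
rewrite -/(hue p x y) (const (fun x => hue p x y) (hx y)).
exact: (const (fun y => hue p 0 y) (hy 0)).
Qed.

Lemma pure_ok a : plane_ok (pure a).
Proof. by []. Qed.

Lemma stack_pure a b : adj a b -> stack_ok (pure a) (pure b).
Proof. by move=> ab x y; split. Qed.

Lemma stack_mid p q : stack_ok p q -> adj (mid p) (mid q).
Proof. by move=> /(_ 0 0)[]. Qed.

(** Purifying a plane, that is, replacing it by the pure plane of the hue at its
    origin, respects its neighbors: if it is not already pure, they are. *)
Lemma stack_pure_r p q : plane_ok p -> plane_ok q -> stack_ok p q ->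
  stack_ok p (pure (mid q)).
Proof.
move=> okp okq st; have [full|full] := stack_full okp okq st.
  rewrite (full_pure okp full); apply: stack_pure; exact: stack_mid.
by rewrite -full_pure.
Qed.

Lemma stack_pure_l p q : plane_ok p -> plane_ok q -> stack_ok p q ->
  stack_ok (pure (mid p)) q.
Proof.
move=> okp okq st; have [full|full] := stack_full okp okq st.
  by rewrite -full_pure.
rewrite (full_pure okq full); apply: stack_pure; exact: stack_mid.
Qed.

(** The hue [c] is that of the plane itself if it is pure, and else that of the
    pure plane above it. *)
Lemma plane_center (f : int -> plane) z : stacked f ->
  exists c, forall x y, adj c (hue (f z) x y).
Proof.
move=> st; have [okz stz] := st z; have [okz1 _] := st (z + 1).
have [full|full] := stack_full okz okz1 stz.
  by exists (mid (f z)) => x y; rewrite (full_pure okz full) adj_refl.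
exists (mid (f (z + 1))) => x y; have [_ _ _] := stz x y.
by rewrite (full_pure okz1 full) adj_sym.
Qed.

End Planes.

(** * The subshift of stacked planes *)

Section Coordinates.

Definition lattice : zmodType := 'rV[int]_3.

Definition pt (x y z : int) : lattice := \row_i [:: x; y; z]`_i.
Definition cx (g : lattice) : int := g 0 ord0.
Definition cy (g : lattice) : int := g 0 (@Ordinal 3 1 isT).
Definition cz (g : lattice) : int := g 0 (@Ordinal 3 2 isT).

Lemma ptK x y z : (cx (pt x y z) = x) * (cy (pt x y z) = y) * (cz (pt x y z) = z).
Proof. by rewrite /cx /cy /cz !mxE. Qed.

Lemma coordD g h :
  (cx (g + h) = cx g + cx h) * (cy (g + h) = cy g + cy h)
  * (cz (g + h) = cz g + cz h).
Proof. by rewrite /cx /cy /cz !mxE. Qed.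

Lemma coordN g : (cx (- g) = - cx g) * (cy (- g) = - cy g) * (cz (- g) = - cz g).
Proof. by rewrite /cx /cy /cz !mxE. Qed.

Lemma pt_coord g : pt (cx g) (cy g) (cz g) = g.
Proof.
apply/rowP => i; rewrite mxE /cx /cy /cz.
by case: i => [[|[|[|//]]] Hi] /=; congr (g 0 _); exact: val_inj.
Qed.

Definition planes (c : lattice -> cell) : int -> plane :=
  fun z x y => c (pt x y z).

Definition config_of (f : int -> plane) : config lattice cell :=
  fun g => f (cz g) (cx g) (cy g).

Lemma config_ofK f : planes (config_of f) = f.
Proof.
apply/funext => z; apply/funext => x; apply/funext => y.
by rewrite /planes /config_of !ptK.
Qed.

Lemma planesK c : config_of (planes c) = c.
Proof. by apply/funext => g; rewrite /planes /config_of pt_coord. Qed.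

Definition origin_rule (c : lattice -> cell) : Prop :=
  plane_rule (planes c 0) 0 0 /\ stack_rule (planes c 0) (planes c (0 + 1)) 0 0.

(** The cells on which [origin_rule] depends, written as they occur in it. *)
Definition window : {fset lattice} :=
  [fset g in [:: pt 0 0 0; pt 0 (0 + 1) 0; pt (0 + 1) (0 + 1) 0;
    pt (0 - 1) (0 + 1) 0; pt (0 + 1) 0 0; pt (0 - 1) 0 (0 + 1);
    pt 0 0 (0 + 1); pt (0 + 1) 0 (0 + 1)]]%fset.

Lemma origin_rule_local (c d : lattice -> cell) :
  (forall w, w \in window -> c w = d w) -> origin_rule c -> origin_rule d.
Proof.
move=> H; rewrite /origin_rule /plane_rule /stack_rule /land /hue /planes.
by rewrite !H // !inE eqxx ?orbT.
Qed.

Definition island_shift : subshift lattice cell := local_shift origin_rule_local.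

Lemma island_shiftP c : subshift_set island_shift c <-> stacked (planes c).
Proof.
have E g x y z : planes (fun h => c (g + h)) z x y =
    planes c (cz g + z) (cx g + x) (cy g + y).
  rewrite /planes; congr c; rewrite -[g in LHS]pt_coord.
  by apply/rowP => i; rewrite !mxE; case: i => [[|[|[|//]]] Hi].
split=> H.
  have R x y z : plane_rule (planes c z) x y /\
      stack_rule (planes c z) (planes c (z + 1)) x y.
    have := H (pt x y z).
    rewrite /origin_rule /plane_rule /stack_rule /land /hue !E !ptK.
    by rewrite !addr0 !add0r.
  by move=> z; split=> x y; have [] := R x y z.
move=> g; have [ok st] := H (cz g).
have := st (cx g) (cy g); have := ok (cx g) (cy g).
rewrite /origin_rule /plane_rule /stack_rule /land /hue !E.
by rewrite !addr0 !add0r.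
Qed.

Definition stack (c : island_shift) : int -> plane := planes (val c).

Lemma stackP (c : island_shift) : stacked (stack c).
Proof. apply/island_shiftP; exact: set_valP. Qed.

Lemma config_of_in f : stacked f -> config_of f \in (island_shift : set _).
Proof. by move=> st; apply/mem_set/island_shiftP; rewrite config_ofK. Qed.

Definition point_of f (st : stacked f) : island_shift := SigSub (config_of_in st).

Lemma point_ofK f (st : stacked f) : stack (point_of st) = f.
Proof. exact: config_ofK. Qed.

Lemma stack_inj (c d : island_shift) : stack c = stack d -> c = d.
Proof.
by move=> e; apply: val_inj; rewrite -[LHS]planesK -[RHS]planesK -/(stack c) e.
Qed.

Lemma stack_act g (c : island_shift) z x y :
  stack (subshift_act g c) z x y = stack c (z - cz g) (x - cx g) (y - cy g).
Proof.
rewrite /stack /planes /= /config_shift; congr (val c _).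
by rewrite -[LHS]pt_coord !coordD !coordN !ptK.
Qed.

Lemma fset_bounded (D : {fset lattice}) : exists n : nat, forall h, h \in D ->
  [/\ `|cx h| <= n%:Z, `|cy h| <= n%:Z & `|cz h| <= n%:Z].
Proof.
exists (\sum_(h <- D) (`|cx h| + `|cy h| + `|cz h|))%N => h hD.
rewrite (big_rem h) //=; by split; lia.
Qed.

Lemma nbhs_stack (c : island_shift) U : nbhs c U -> exists n : nat,
  forall d : island_shift,
  (forall z x y, `|z| <= n%:Z -> `|x| <= n%:Z -> `|y| <= n%:Z ->
     stack d z x y = stack c z x y) -> U d.
Proof.
move=> /subshift_nbhs_agree[D HD]; have [n Hn] := fset_bounded D.
exists n => d Hd; apply: HD => h /Hn[hx hy hz].
by have := Hd _ _ _ hz hx hy; rewrite /stack /planes pt_coord.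
Qed.

Lemma stack_nbhs (c : island_shift) z x y :
  nbhs c [set d : island_shift | stack d z x y = stack c z x y].
Proof.
apply: filterS (subshift_agree_nbhs [fset pt x y z]%fset c) => d; apply.
by rewrite inE.
Qed.

End Coordinates.

(** * Entropy pairs have close hues *)

Section Bound.

Definition adj2 (a b : 'Z_7) : bool := (b - a) \in [:: 0; 1; -1; 2; -2].

Lemma adj_adj2 (a b c : 'Z_7) : adj c a -> adj c b -> adj2 a b.
Proof.
rewrite /adj /adj2; have -> : b - a = (b - c) - (a - c) by ring.
move: (a - c) (b - c) => d e; rewrite !inE.
by move=> /or3P[] /eqP-> /or3P[] /eqP->.
Qed.

(** Two hues at distance more than 2 are not both next to the center of a plane,
    so that each plane misses one of them. *)
Lemma itinerary_of_planes (f : int -> plane) (a b : 'Z_7) : stacked f ->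
  ~~ adj2 a b -> exists w : int -> bool, forall z x y,
    if w z then hue (f z) x y <> a else hue (f z) x y <> b.
Proof.
move=> st nab; exists (fun z => `[< forall x y, hue (f z) x y <> a >]) => z x y.
have [c Hc] := plane_center z st.
case: asboolP => [|/existsNP[x' /existsNP[y' /contrapT ha]]] hb; first exact.
by move/negP: nab; apply; apply: (@adj_adj2 _ _ c); rewrite -?ha -?hb.
Qed.

(** In each plane that meets [F], a point of [F] is sent out of [F] by the
    translation along [x]. *)
Lemma planes_le_escape (F : {fset lattice}) :
  (#|` [fset cz g | g in F]%fset| <= escape (pt 1 0 0) F)%N.
Proof.
pose E := [fset a in F | (pt 1 0 0 + a)%R \notin F]%fset.
apply: (@leq_trans #|` [fset cz g | g in E]%fset|); last exact: leq_imfset_card.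
apply: fsubset_leq_card; apply/fsubsetP => k /imfsetP[g /= gF ->{k}].
have col (n : nat) : cz (g + pt n%:Z 0 0) = cz g by rewrite coordD !ptK addr0.
suff [n nE] : exists n : nat, g + pt n%:Z 0 0 \in E.
  by rewrite -(col n); exact: in_imfset.
apply: contrapT => /forallNP no.
have inF (n : nat) : g + pt n%:Z 0 0 \in F.
  elim: n => [|n IH].
    rewrite (_ : pt 0 0 0 = 0) ?addr0 //.
    by apply/rowP => i; rewrite !mxE; case: i => [[|[|[|//]]] Hi].
  have /negP := no n; rewrite !inE /= IH /= negbK addrCA.
  rewrite (_ : pt 1 0 0 + pt n%:Z 0 0 = pt n.+1%:Z 0 0) //.
  by apply/rowP => i; rewrite !mxE; case: i => [[|[|[|//]]] Hi].
pose s := [seq g + pt n%:Z 0 0 | n <- iota 0 #|` F|.+1].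
have us : uniq s.
  rewrite map_inj_uniq ?iota_uniq // => n m /addrI /(congr1 cx).
  by rewrite !ptK => -[].
have : (size s <= size F)%N.
  by apply: uniq_leq_size => // h /mapP[n _ ->]; exact: inF.
by rewrite size_map size_iota ltnn.
Qed.

Variable R : realType.
Variable F : nat -> {fset lattice}.
Hypothesis folnerF : is_folner R F.

(** If the hues were farther apart, the cover by the two conditions of having
    another hue at that cell would have zero entropy: one choice per plane is
    enough, and a Folner set meets few planes. *)
Lemma entropy_pair_close (u v : island_shift) z x y :
  entropy_pairs R (subshift_act (X := island_shift)) F (u, v) ->
  adj2 (hue (stack u z) x y) (hue (stack v z) x y).
Proof.
move=> [_ /= Huv]; apply/negPn/negP => nab.
pose V (a : 'Z_7) := [set w : island_shift | hue (stack w z) x y = a].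
set a := hue _ _ _ in nab; set b := hue (stack v z) x y in nab.
have ab : a <> b by move=> e; move: nab; rewrite e /adj2 subrr.
have VN (w : island_shift) : nbhs w (V (hue (stack w z) x y)).
  by apply: filterS (stack_nbhs w z x y) => w' /= e; rewrite /V /= /hue e.
have Vcl c : closed (V c).
  rewrite -[V c]setCK; apply: open_closedC; rewrite openE => w /= Vw.
  by apply: filterS (VN w) => w' Vw' e; apply: Vw; rewrite /V /= -Vw'.
have dis : V a `&` V b = set0.
  by apply/seteqP; split=> // w [ea eb]; case: ab; rewrite -[LHS]ea -[RHS]eb.
have := Huv _ _ (Vcl a) (VN u) (Vcl b) (VN v) dis.
pose W c := if c then ~` V a else ~` V b.
have Wcov w : W true w \/ W false w.
  have [e|] := pselect (V a w); last by left.
  by right=> e'; have : (V a `&` V b) w by []; rewrite dis.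
rewrite -[[set _; _]]/[set W true; W false].
have -> := @htop_le0_slow _ _ (subshift_act (X := island_shift)) u
  (@subshift_act0 _ _ _) (@subshift_actD _ _ _) W Wcov R F folnerF
  (fun n => #|` [fset cz g | g in F n]%fset|).
- by rewrite ltxx.
- apply: (squeeze_cvgr _ (cvg_cst (0:R)) (folner_escape folnerF (pt 1 0 0))).
  apply: nearW => n; rewrite divr_ge0 //= ler_wpM2r ?invr_ge0 // ler_nat.
  exact: planes_le_escape.
- move=> n; apply: itineraries_factor => w.
  have [d Hd] := itinerary_of_planes (stackP w) nab.
  exists (fun k => d (z - k)) => g _.
  have := Hd (z - cz g) (x - cx g) (y - cy g).
  by rewrite /hue -stack_act /W; case: (d _).
Qed.

End Bound.

(** * Drift is bounded along chains of entropy pairs *)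

Section Drift.

(** The representative in [-3, 3]. *)
Definition centered (a : 'Z_7) : int := if (a <= 3)%N then a%:Z else a%:Z - 7.

(** The two sides agree modulo 7. They are at most 4 and 2 in absolute value, and
    two integers at distance at most 6 that agree modulo 7 are equal. *)
Lemma centered_shift (a b a' b' : 'Z_7) :
  adj2 a b -> adj a a' -> adj b b' -> adj2 a' b' ->
  centered (b' - a') - centered (b - a) = centered (b' - b) - centered (a' - a).
Proof.
rewrite /adj /adj2 (_ : b' - a' = (b - a) + (b' - b) - (a' - a)); last by ring.
move: (b - a) (b' - b) (a' - a) => e d' d; rewrite !inE.
move=> /or4P[/eqP->|/eqP->|/eqP->|/orP[/eqP->|/eqP->]];
  by move=> /or3P[] /eqP-> /or3P[] /eqP->.
Qed.

Lemma centered_bound (a b : 'Z_7) : adj2 a b -> `|centered (b - a)| <= 2.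
Proof.
rewrite /adj2; move: (b - a) => e; rewrite !inE.
by move=> /or4P[/eqP->|/eqP->|/eqP->|/orP[/eqP->|/eqP->]].
Qed.

Definition drift (f : int -> plane) (n : nat) : int :=
  \sum_(i < n) centered (mid (f i.+1%:Z) - mid (f i%:Z)).

(** The two drifts differ by the change, from height 0 to height [n], of the hue
    difference of the two points. *)
Lemma drift_close (f g : int -> plane) : stacked f -> stacked g ->
  (forall z, adj2 (mid (f z)) (mid (g z))) ->
  forall n, `|drift f n - drift g n| <= 4.
Proof.
move=> sf sg fg n.
have E : drift g n - drift f n =
    centered (mid (g n%:Z) - mid (f n%:Z)) - centered (mid (g 0) - mid (f 0)).
  elim: n => [|n IH]; first by rewrite /drift !big_ord0 !subrr.
  rewrite /drift !big_ord_recr /= -!/(drift _ _).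
  have st h : stacked h -> adj (mid (h n%:Z)) (mid (h n.+1%:Z)).
    by move=> sh; have [_ /stack_mid] := sh n%:Z; rewrite -addn1.
  have := centered_shift (fg n%:Z) (st f sf) (st g sg) (fg n.+1%:Z).
  move: IH; lia.
have := centered_bound (fg n%:Z); have := centered_bound (fg 0); lia.
Qed.

Definition bounded_drift : set (island_shift * island_shift) :=
  [set p | exists C : nat, forall n,
     `|drift (stack p.1) n - drift (stack p.2) n| <= C%:Z].

Lemma bounded_drift_equivalence : is_equivalence bounded_drift.
Proof.
split.
- by move=> u; exists 0%N => n; rewrite subrr.
- by move=> u v [C H]; exists C => n; rewrite distrC; exact: H.
- move=> u v w [C H] [D K]; exists (C + D)%N => n.
  have := H n; have := K n; rewrite /=; lia.
Qed.

Definition pure_stack (a : int -> 'Z_7) : int -> plane := fun z => pure (a z).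

Lemma pure_stacked a : (forall z, adj (a z) (a (z + 1))) -> stacked (pure_stack a).
Proof. by move=> H z; split; [exact: pure_ok | apply: stack_pure]. Qed.

Lemma flat_stacked : stacked (pure_stack (fun=> 0)).
Proof. by apply: pure_stacked => z; exact: adj_refl. Qed.

Lemma slope_stacked : stacked (pure_stack (fun z => z%:~R)).
Proof. by apply: pure_stacked => z; rewrite /adj intrD addrC addKr. Qed.

Lemma drift_flat n : drift (pure_stack (fun=> 0)) n = 0.
Proof. by apply: big1 => i _; rewrite /mid /hue /= subrr. Qed.

Lemma drift_slope n : drift (pure_stack (fun z => z%:~R)) n = n%:Z.
Proof.
have -> : drift (pure_stack (fun z => z%:~R)) n = \sum_(i < n) 1.
  apply: eq_bigr => i _; rewrite /mid /hue /=.
  have -> : (i.+1%:Z)%:~R - (i%:Z)%:~R = 1 :> 'Z_7 by rewrite -intrB (_ : _ - _ = 1) //; lia.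
  by [].
by rewrite sumr_const card_ord; lia.
Qed.

Variables (R : realType) (F : nat -> {fset lattice}).
Hypothesis folnerF : is_folner R F.

Let E1 := cpe_rel R (subshift_act (X := island_shift)) F 1.

(** Chains of entropy pairs cannot join a slope, of unbounded drift, to the flat
    point. *)
Lemma cpe2_proper : equiv_closure E1 <> setT.
Proof.
have sub : equiv_closure E1 `<=` bounded_drift.
  apply: smallest_sub; first exact: bounded_drift_equivalence.
  move=> [u v] [uv|/= <-]; last by exists 0%N => n; rewrite subrr.
  exists 4%N; apply: drift_close; [exact: stackP | exact: stackP |] => z.
  exact: entropy_pair_close folnerF _ _ _ _ _ uv.
move=> e.
have /sub[C /(_ C.+1) /=] :
    equiv_closure E1 (point_of slope_stacked, point_of flat_stacked) by rewrite e.
rewrite !point_ofK drift_flat drift_slope; lia.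
Qed.

End Drift.

(** * Planes tiled by trimmed islands *)

Section Tiles.
Implicit Types (p : plane) (a b : 'Z_7) (x y s t : int).

Lemma divz_mod_near (L x e : int) : 0 <= (x %% L)%Z + e < L ->
  ((x + e) %/ L)%Z = (x %/ L)%Z /\ ((x + e) %% L)%Z = (x %% L)%Z + e.
Proof.
move=> H; have L0 : L != 0 by lia.
have -> : x + e = (x %/ L)%Z * L + ((x %% L)%Z + e) by rewrite addrA -divz_eq.
move: (x %/ L)%Z (x %% L)%Z H => q r H.
by rewrite divzMDl // modzMDl divz_small ?addr0 ?modz_small //; lia.
Qed.

(** It goes up from [a] one hue at a time and stops at [b], after at most 6
    steps. *)
Definition color_path a b (j : nat) : 'Z_7 := a + (minn j (b - a)%R)%:R.

Lemma color_path0 a b : color_path a b 0 = a.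
Proof. by rewrite /color_path min0n addr0. Qed.

Lemma color_path_end a b (j : nat) : (6 <= j)%N -> color_path a b j = b.
Proof.
move=> j6; rewrite /color_path (minn_idPr _).
  by rewrite natr_Zp addrC subrK.
by apply: leq_trans j6; rewrite -ltnS ltn_ord.
Qed.

Lemma color_path_adj a b (j : nat) : adj (color_path a b j) (color_path a b j.+1).
Proof.
rewrite /color_path /adj opprD addrACA subrr add0r.
have [jk|jk] := ltnP j (b - a)%R.
  by rewrite (minn_idPl jk) mulrS addrK.
by rewrite (minn_idPr (leqW jk)) subrr.
Qed.

Variable n : nat.

(** A triangle with its tip at the bottom that contains the square of radius
    [n]. *)
Definition tri s t : bool := (t <= n%:Z) && (`|s| <= t + (n.*2)%:Z).

Definition trim p a : plane := fun s t => if tri s t then p s t else (a, false).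

(** The rules on the land set are Horn clauses, so that they survive the
    intersection with a triangle that obeys them. *)
Lemma trim_ok p a : plane_ok p -> plane_ok (trim p a).
Proof.
move=> ok s t; have [E U C1 C2] := ok s t.
rewrite /plane_rule /trim /land /hue; split.
- case: ifP => // T1; case: ifP => // T2 l1 l2.
  have [E1 E2] := E l1 l2; rewrite /land in E1 E2.
  by rewrite !ifT //; move: T1 T2; rewrite /tri; lia.
- case: ifP => // T1; case: ifP => // T2; case: ifP => // T3 l1 l2 l3.
  rewrite ifT; first exact: U.
  by move: T1 T2 T3; rewrite /tri; lia.
- by case: ifP => // _; case: ifP => // _; exact: C1.
- by case: ifP => // _; case: ifP => // _; exact: C2.
Qed.

(** The triangle has half-width [3 * n]; the side leaves a column of sea on each
    flank, so that the neighbors of a triangle are in the same tile. *)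
Definition side : int := (6 * n + 3)%N%:Z.
Definition offset : int := (3 * n + 1)%N%:Z.
Definition tile x : int := ((x + offset) %/ side)%Z.
Definition local x : int := ((x + offset) %% side)%Z - offset.

Lemma tile_near x e : `|local x| <= (3 * n)%N%:Z -> `|e| <= 1 ->
  tile (x + e) = tile x /\ local (x + e) = local x + e.
Proof.
rewrite /tile /local => Hx He.
have [|] := @divz_mod_near side (x + offset) e.
  move: Hx; move: (_ %% _)%Z => r; rewrite /side /offset; lia.
rewrite addrAC => -> ->; split => //; lia.
Qed.

Definition tiled (w : int -> int -> plane) a : plane := fun x y =>
  trim (w (tile x) (tile y)) a (local x) (local y).

Lemma tiled_near w a x y dx dy : tri (local x) (local y) ->
  `|dx| <= 1 -> `|dy| <= 1 ->
  tiled w a (x + dx) (y + dy) =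
  trim (w (tile x) (tile y)) a (local x + dx) (local y + dy).
Proof.
rewrite /tri /tiled => T hx hy.
have [->  ->] := @tile_near x dx ltac:(lia) hx.
by have [-> ->] := @tile_near y dy ltac:(lia) hy.
Qed.

Lemma tiled_ok w a : (forall q r, plane_ok (w q r)) -> plane_ok (tiled w a).
Proof.
move=> ok x y.
have nothing x' y' : ~~ tri (local x') (local y') -> land (tiled w a) x' y' = false.
  by rewrite /land /tiled /trim => /negbTE ->.
have [T|T] := boolP (tri (local x) (local y)).
  have := trim_ok a (ok (tile x) (tile y)) (local x) (local y).
  rewrite /plane_rule /land /hue.
  have N dx dy := @tiled_near w a x y dx dy T.
  have := N 0 0 isT isT; have := N 1 0 isT isT; have := N 0 1 isT isT.
  have := N 1 1 isT isT; have := N (-1) 1 isT isT.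
  by rewrite !addr0 => -> -> -> -> ->.
split; rewrite ?(nothing x y) //.
have [T'|T'] := boolP (tri (local x) (local (y + 1))); last by rewrite (nothing x (y + 1)).
have N dx dy := @tiled_near w a x (y + 1) dx dy T'.
have [_ + _ _] := trim_ok a (ok (tile x) (tile (y + 1))) (local x) (local (y + 1) - 1).
have := N 0 (-1) isT isT; have := N 0 0 isT isT.
have := N 1 0 isT isT; have := N (-1) 0 isT isT.
rewrite /land !addr0 subrK addrK => -> -> -> E.
move=> H h1 h2 h3; move: (H h1 h2 h3); rewrite -E -/(land _ x y) nothing //.
Qed.

Lemma tiled_stack_up w a b : adj a b ->
  (forall q r, stack_ok (w q r) (pure b)) -> stack_ok (tiled w a) (pure b).
Proof.
move=> ab st x y; rewrite /stack_rule /hue /land /= !orbT; split => //.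
rewrite /tiled /trim; case: ifP => // _.
by have [] := st (tile x) (tile y) (local x) (local y).
Qed.

Lemma tiled_stack_down w a b : adj b a ->
  (forall q r, stack_ok (pure b) (w q r)) -> stack_ok (pure b) (tiled w a).
Proof.
move=> ab st x y; rewrite /stack_rule /hue /land /=; split => //.
rewrite /tiled /trim; case: ifP => // _.
by have [] := st (tile x) (tile y) (local x) (local y).
Qed.

Lemma tileE q s : `|s| <= n%:Z ->
  tile (q * side + s) = q /\ local (q * side + s) = s.
Proof.
move=> Hs; rewrite /tile /local -addrA divzMDl ?modzMDl; last by rewrite /side; lia.
by rewrite divz_small ?modz_small; rewrite /side /offset; lia.
Qed.

End Tiles.

(** * Independent patterns on isolated planes *)

Section Mosaic.
Variables (u v : int -> plane) (n : nat).
Hypotheses (su : stacked u) (sv : stacked v).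

(** Planes on which nothing has to be chosen between [u] and [v]. *)
Definition calm (z : int) : Prop := u z = pure (mid (u z)) /\ v z = u z.

Hypothesis sparse : forall z, calm z \/ calm (z + 1).

(** The levels of a period run from [- n.+1] to [n + 7]: the window and one plane
    on either side of it, then six steps back to the first hue. *)
Definition period : int := (2 * n + 9)%N%:Z.
Definition level (z : int) : int := ((z + n.+1%:Z) %% period)%Z - n.+1%:Z.
Definition layer (z : int) : int := ((z + n.+1%:Z) %/ period)%Z.

Lemma level_range z : - n.+1%:Z <= level z <= n%:Z + 7.
Proof.
have p0 : 0 < period by rewrite /period; lia.
rewrite /level; have := modz_ge0 (z + n.+1%:Z) (lt0r_neq0 p0).
have := ltz_pmod (z + n.+1%:Z) p0.
by move: (_ %% _)%Z => r; rewrite /period; lia.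
Qed.

Lemma level_next z : level z < n%:Z + 7 -> level (z + 1) = level z + 1.
Proof.
move=> H; have := level_range z; rewrite /level in H *.
have [|_] := @divz_mod_near period (z + n.+1%:Z) 1.
  have := level_range z; rewrite /level.
  by move: H; move: (_ %% _)%Z => r; rewrite /period; lia.
by rewrite addrAC => -> _; lia.
Qed.

Lemma level_wrap z : level z = n%:Z + 7 -> level (z + 1) = - n.+1%:Z.
Proof.
rewrite /level => H.
have -> : z + 1 + n.+1%:Z =
    (((z + n.+1%:Z) %/ period)%Z + 1) * period + 0.
  rewrite mulrDl mul1r addr0 addrAC {1}(divz_eq (z + n.+1%:Z) period) -!addrA.
  by congr (_ + _); move: H; rewrite /period; lia.
by rewrite modzMDl mod0z; lia.
Qed.

Definition fill (i : int) : 'Z_7 :=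
  if i <= n.+1%:Z then mid (u i)
  else color_path (mid (u n.+1%:Z)) (mid (u (- n.+1%:Z))) (absz (i - n.+1%:Z)%R).

Lemma fill_next i : adj (fill i) (fill (i + 1)).
Proof.
rewrite /fill; have [h|h] := leP (i + 1) n.+1%:Z.
  rewrite ifT; last lia.
  by have [_ /stack_mid] := su i.
have [h'|h'] := leP i n.+1%:Z.
  have -> : i = n.+1%:Z by lia.
  rewrite (_ : absz (n.+1%:Z + 1 - n.+1%:Z)%R = 1%N); last lia.
  by rewrite -[X in adj X _](color_path0 _ (mid (u (- n.+1%:Z)))) color_path_adj.
rewrite (_ : absz (i + 1 - n.+1%:Z)%R = (absz (i - n.+1%:Z)%R).+1); last lia.
exact: color_path_adj.
Qed.

Lemma fill_end : fill (n%:Z + 7) = mid (u (- n.+1%:Z)).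
Proof. by rewrite /fill ifF ?color_path_end //; lia. Qed.

(** The bit [w q r j] chooses between the patterns of [u] and of [v] in the tile
    [(q, r)] of the layer [j]. *)
Definition mosaic (w : int -> int -> int -> bool) (z : int) : plane :=
  if (`|level z| <= n%:Z) && ~~ `[< calm (level z) >] then
    tiled n (fun q r => if w q r (layer z) then u (level z) else v (level z))
      (mid (u (level z)))
  else pure (fill (level z)).

Lemma mosaic_stacked w : stacked (mosaic w).
Proof.
have side_up i : calm (i + 1) -> stack_ok (u i) (pure (mid (u (i + 1)))) /\
    stack_ok (v i) (pure (mid (u (i + 1)))).
  move=> [e1 e2]; have [_ h1] := su i; have [_ h2] := sv i.
  by rewrite -e1; split => //; rewrite -e2.
have side_down i : calm i -> stack_ok (pure (mid (u i))) (u (i + 1)) /\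
    stack_ok (pure (mid (u i))) (v (i + 1)).
  move=> [e1 e2]; have [_ h1] := su i; have [_ h2] := sv i.
  by rewrite -e1; split => //; rewrite -e2.
move=> z; split.
  rewrite /mosaic; case: ifP => _; last exact: pure_ok.
  by apply: tiled_ok => q r; case: (w q r _); [case: (su (level z)) | case: (sv (level z))].
have [full|H] := eqVneq (level z) (n%:Z + 7).
  rewrite /mosaic (level_wrap full) full ifF ?ifF; try lia.
  apply: stack_pure; rewrite fill_end /fill.
  have -> : - n.+1%:Z <= n.+1%:Z by lia.
  exact: adj_refl.
have lz := level_range z.
rewrite /mosaic (level_next (z := z)); last lia.
move: (level z) lz H (layer z) (layer (z + 1)) => i lz H j j'.
case: ifP => [/andP[iN /asboolPn ci]|].
  have ci1 : calm (i + 1) by case: (sparse i).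
  rewrite ifF; last by rewrite asboolT // andbF.
  have -> : fill (i + 1) = mid (u (i + 1)) by rewrite /fill ifT //; lia.
  apply: tiled_stack_up; first by have [_ /stack_mid] := su i.
  by move=> q r; have [] := side_up _ ci1; case: (w q r j).
move=> _; case: ifP => [/andP[iN /asboolPn ci]|_]; last first.
  by apply: stack_pure; exact: fill_next.
have ci0 : calm i by case: (sparse i).
have -> : fill i = mid (u i) by rewrite /fill ifT //; lia.
apply: tiled_stack_down; first by have [_ /stack_mid] := su i.
by move=> q r; have [] := side_down _ ci0; case: (w q r j').
Qed.

Lemma mosaicE w (q r j z x y : int) :
  `|z| <= n%:Z -> `|x| <= n%:Z -> `|y| <= n%:Z ->
  mosaic w (j * period + z) (q * side n + x) (r * side n + y) =
  if w q r j then u z x y else v z x y.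
Proof.
move=> hz hx hy.
have [lz jz] : level (j * period + z) = z /\ layer (j * period + z) = j.
  rewrite /level /layer -(addrA (j * period)) divzMDl ?modzMDl; last by rewrite /period; lia.
  by rewrite divz_small ?modz_small; rewrite /period; lia.
have [c|c] := pselect (calm z); last first.
  have -> : mosaic w (j * period + z) =
      tiled n (fun q r => if w q r j then u z else v z) (mid (u z)).
    by rewrite /mosaic lz jz hz asboolF.
  have [tx lx] := tileE q hx; have [ty ly] := tileE r hy.
  have T : tri n x y by rewrite /tri; lia.
  rewrite /tiled tx ty lx ly /trim T.
  by case: (w q r j).
have -> : mosaic w (j * period + z) = pure (fill z).
  by rewrite /mosaic lz jz hz asboolT.
have -> : fill z = mid (u z) by rewrite /fill ifT //; lia.
have [e1 e2] := c; have e := congr1 (fun p : plane => p x y) e1.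
by rewrite e2 if_same e.
Qed.

End Mosaic.

Section Independence.

Lemma pigeonhole (G : choiceType) (C : finType) (cl : G -> C) (F : {fset G}) :
  (0 < #|C|)%N ->
  exists c, (#|` F| <= #|C| * #|` [fset g in F | cl g == c]%fset|)%N.
Proof.
move=> C0; apply: contrapT => /forallNP no.
have : (\sum_(c : C) #|C| * #|` [fset g in F | cl g == c]%fset| <
        \sum_(c : C) #|` F|)%N.
  have /card_gt0P[c0 _] := C0.
  rewrite (bigD1 c0) //= [ltnRHS](bigD1 c0) //= -addSn leq_add //.
    by rewrite ltnNge; apply/negP; exact: no.
  by apply: leq_sum => c _; rewrite leqNgt; apply/negP => /ltnW; exact: no.
rewrite sum_nat_const -big_distrr /= ltn_pmul2l //.
suff -> : (\sum_(c : C) #|` [fset g in F | cl g == c]%fset| = #|` F|)%N by rewrite ltnn.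
under eq_bigr => c _ do rewrite card_fset_sum1 big_fset /= big_mkcond /=.
rewrite exchange_big /= card_fset_sum1; apply: eq_bigr => g _.
by rewrite -big_mkcond /= (big_pred1 (cl g)) // => c; rewrite /= eq_sym.
Qed.

Variables (R : realType) (F : nat -> {fset lattice}).
Hypothesis folnerF : is_folner R F.

(** The patterns of [u] and [v] can be placed at will in the boxes of a mosaic.
    By the pigeonhole principle, a set [F k] contains a fixed proportion of
    translations that carry boxes to the window at the origin. *)
Lemma isolated_entropy_pair (u v : island_shift) :
  (forall z, calm (stack u) (stack v) z \/ calm (stack u) (stack v) (z + 1)) ->
  cpe_rel R (subshift_act (X := island_shift)) F 1 (u, v).
Proof.
move=> sparse.
have [->|uv] := pselect (u = v); [by right | left; split => //= Ux Uy _ nu _ nv dis].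
have [n1 Hu] := nbhs_stack nu; have [n2 Hv] := nbhs_stack nv.
pose n := maxn n1 n2.
pose W b := if b then ~` Ux else ~` Uy.
have Wcov x : W true x \/ W false x.
  have [e|] := pselect (Ux x); last by left.
  by right=> e'; have : (Ux `&` Uy) x by []; rewrite dis.
pose C : finType := ('I_(6 * n + 2).+1 * 'I_(6 * n + 2).+1 * 'I_(2 * n + 8).+1)%type.
pose cl (g : lattice) : C :=
  (inord (absz (cx g %% side n)%Z), inord (absz (cy g %% side n)%Z),
   inord (absz (cz g %% period n)%Z)).
have C0 : (0 < #|C|)%N by apply/card_gt0P; exists (ord0, ord0, ord0).
rewrite -[[set _; _]]/[set W true; W false].
apply: (htop_gt0_independent u (@subshift_act0 _ _ _) (@subshift_actD _ _ _)
  Wcov folnerF C0) => k.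
have [[[a b] d] HJ] := pigeonhole cl (F k) C0.
exists [fset g in F k | cl g == (a, b, d)]%fset.
  by apply/fsubsetP => g; rewrite !inE => /andP[].
split=> // w.
pose om (q r j : int) := w (pt (a%:Z - side n * q) (b%:Z - side n * r)
                            (d%:Z - period n * j)).
have st := mosaic_stacked n (stackP u) (stackP v) sparse om.
exists (subshift_act (pt (- a%:Z) (- b%:Z) (- d%:Z)) (point_of st)) => g.
rewrite !inE => /andP[_ /eqP[ea eb ed]].
have res (m e : int) (N : nat) (i : 'I_N.+1) : e = N.+1%:Z ->
    inord (absz (m %% e)%Z) = i -> m = (m %/ e)%Z * e + i%:Z.
  move=> -> <-; rewrite {1}(divz_eq m N.+1%:Z); congr (_ + _).
  have lt := ltz_pmod m (isT : 0 < N.+1%:Z).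
  have ge := modz_ge0 m (isT : N.+1%:Z != 0).
  by rewrite inordK; lia.
have ga := res (cx g) (side n) (6 * n + 2)%N a ltac:(rewrite /side; lia) ea.
have gb := res (cy g) (side n) (6 * n + 2)%N b ltac:(rewrite /side; lia) eb.
have gd := res (cz g) (period n) (2 * n + 8)%N d ltac:(rewrite /period; lia) ed.
have near_uv z x y : `|z| <= n%:Z -> `|x| <= n%:Z -> `|y| <= n%:Z ->
    stack (subshift_act g (subshift_act (pt (- a%:Z) (- b%:Z) (- d%:Z))
      (point_of st))) z x y = if w g then stack u z x y else stack v z x y.
  move=> hz hx hy; rewrite !stack_act point_ofK !ptK !opprK.
  have -> : z - cz g + d%:Z = - (cz g %/ period n)%Z * period n + z.
    by rewrite {1}gd; ring.
  have -> : x - cx g + a%:Z = - (cx g %/ side n)%Z * side n + x.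
    by rewrite {1}ga; ring.
  have -> : y - cy g + b%:Z = - (cy g %/ side n)%Z * side n + y.
    by rewrite {1}gb; ring.
  rewrite mosaicE // /om (_ : pt _ _ _ = g) //.
  rewrite -[RHS]pt_coord; congr pt.
  - by rewrite [RHS]ga; ring.
  - by rewrite [RHS]gb; ring.
  - by rewrite [RHS]gd; ring.
have n1n : n1%:Z <= n%:Z by rewrite lez_nat leq_maxl.
have n2n : n2%:Z <= n%:Z by rewrite lez_nat leq_maxr.
rewrite /W; case: ifP => wg; apply; [apply: Hu | apply: Hv] => z x y hz hx hy;
  by rewrite near_uv ?wg //; apply: le_trans; eassumption.
Qed.

End Independence.

(** * Gluing planes and weak mixing *)

Section Gluing.

(** A plane that is kept has next to it either the plane that it had in a valid
    point [f] or the purification of that plane, which [stack_pure_l] and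
    [stack_pure_r] allow. *)
Lemma glue_stacked (S : int -> bool) (w : int -> plane) (b : int -> 'Z_7) :
  (forall z, adj (b z) (b (z + 1))) ->
  (forall z, S z -> exists2 f, stacked f & forall z', `|z' - z| <= 1 ->
     (S z' -> w z' = f z') /\ b z' = mid (f z')) ->
  stacked (fun z => if S z then w z else pure (b z)).
Proof.
move=> adjb loc z; split.
  case: ifP => // Sz; have [f sf Hf] := loc z Sz.
  by have [-> //] := Hf z ltac:(lia); case: (sf z).
case: ifP => Sz.
  have [f sf Hf] := loc z Sz; have [w0 _] := Hf z ltac:(lia).
  have [w1 b1] := Hf (z + 1) ltac:(lia); rewrite w0 //.
  have [ok st] := sf z; have [ok1 _] := sf (z + 1).
  case: ifP => Sz1; first by rewrite w1.
  by rewrite b1; exact: stack_pure_r.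
case: ifP => Sz1; last exact: stack_pure.
have [f sf Hf] := loc (z + 1) Sz1; have [w1 _] := Hf (z + 1) ltac:(lia).
have [_ b0] := Hf z ltac:(lia); rewrite w1 // b0.
have [ok st] := sf z; have [ok1 _] := sf (z + 1).
exact: stack_pure_l.
Qed.

End Gluing.

Section Mixing.

Lemma shift_stacked f k : stacked f -> stacked (fun z => f (z - k)).
Proof. by move=> sf z; have := sf (z - k); rewrite addrAC. Qed.

(** The planes of [u] and of [v] are separated by pure planes whose hues follow a
    color path. Nothing happens in the horizontal directions. *)
Lemma specification (u v : island_shift) (n : nat) : exists w : island_shift,
  forall z x y, `|z| <= n%:Z ->
    stack w z x y = stack u z x y /\ stack w (z + period n) x y = stack v z x y.
Proof.
pose a := stack u; pose c := stack v; pose K := period n; pose m := n.+1%:Z.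
have sa : stacked a by exact: stackP.
have sc : stacked c by exact: stackP.
pose S (z : int) := (`|z| <= n%:Z) || (`|z - K| <= n%:Z).
pose f (z : int) := if `|z| <= n%:Z then a z else c (z - K).
pose path (z : int) := color_path (mid (a m)) (mid (c (- m))) (absz (z - m)%R).
pose b (z : int) := if z <= m then mid (a z) else if z < K - m then path z
            else mid (c (z - K)).
have bl (z : int) : z <= m -> b z = mid (a z) by rewrite /b => ->.
have br (z : int) : K - m <= z -> b z = mid (c (z - K)).
  by move=> h; rewrite /b ifF ?ifF //; move: h; rewrite /K /period /m; lia.
have bm (z : int) : m <= z -> z < K - m -> b z = path z.
  move=> h1 h2; rewrite /b h2; case: ifP => // h3.
  have -> : z = m by lia.
  by rewrite /path subrr color_path0.
have badj (z : int) : adj (b z) (b (z + 1)).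
  have [h|h] := ltP z m.
    by rewrite !bl; try lia; have [_ /stack_mid] := sa z.
  have [h'|h'] := ltP z (K - m); last first.
    rewrite !br; try lia.
    by have [_ /stack_mid] := sc (z - K); rewrite addrAC.
  have [h''|h''] := ltP (z + 1) (K - m).
    rewrite !bm /path; try lia.
    have -> : absz (z + 1 - m)%R = (absz (z - m)%R).+1 by lia.
    exact: color_path_adj.
  rewrite bm // br // /path color_path_end; last by rewrite /K /period /m in h''; lia.
  by rewrite (_ : z + 1 - K = - m) ?adj_refl //; lia.
have st : stacked (fun z => if S z then f z else pure (b z)).
  apply: glue_stacked => // z Sz; rewrite /S /f.
  have [zn|zn] := boolP (`|z| <= n%:Z).
    exists a => // z' zz'; split; last by apply: bl; rewrite /m; lia.
    case/orP => [-> //|h]; move: h; rewrite /K /period; lia.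
  have zK : `|z - K| <= n%:Z by move: Sz; rewrite /S (negbTE zn).
  exists (fun z => c (z - K)); first exact: shift_stacked.
  move=> z' zz'; split; last by apply: br; rewrite /m; lia.
  case/orP => [h|h]; last by rewrite ifF //; move: h; rewrite /K /period; lia.
  move: h zz' zK; rewrite /K /period; lia.
exists (point_of st) => z x y zn; rewrite point_ofK; split.
  by rewrite /S /f zn.
rewrite -/K /S /f addrK zn orbT ifF //.
by rewrite /K /period; lia.
Qed.

Lemma island_shift_weakly_mixing :
  topologically_weakly_mixing (subshift_act (X := island_shift)).
Proof.
move=> U V oU oV [[x1 x2] Ux] [[y1 y2] Vy].
have [[/= U1 U2] [/= nU1 nU2] U12] := open_nbhs_nbhs (conj oU Ux).
have [[/= V1 V2] [/= nV1 nV2] V12] := open_nbhs_nbhs (conj oV Vy).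
have [p1 H1] := nbhs_stack nU1; have [p2 H2] := nbhs_stack nU2.
have [q1 K1] := nbhs_stack nV1; have [q2 K2] := nbhs_stack nV2.
pose n := (p1 + p2 + q1 + q2)%N; pose g := pt 0 0 (period n).
have [w1 Hw1] := specification x1 y1 n; have [w2 Hw2] := specification x2 y2 n.
have gE (w : island_shift) z x y : stack (subshift_act (- g) w) z x y =
    stack w (z + period n) x y.
  by rewrite stack_act !coordN !ptK !opprK !addr0.
exists g, (w1, w2); split.
  apply: U12; split => /=.
    by apply: H1 => z x y hz _ _; have [] := Hw1 z x y ltac:(rewrite /n; lia).
  by apply: H2 => z x y hz _ _; have [] := Hw2 z x y ltac:(rewrite /n; lia).
exists (subshift_act (- g) w1, subshift_act (- g) w2).
  apply: V12; split => /=.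
    apply: K1 => z x y hz _ _; rewrite gE.
    by have [] := Hw1 z x y ltac:(rewrite /n; lia).
  apply: K2 => z x y hz _ _; rewrite gE.
  by have [] := Hw2 z x y ltac:(rewrite /n; lia).
by rewrite /prod_act /= -!subshift_actD subrr !subshift_act0.
Qed.

End Mixing.

(** * Lowering heights, and density *)

Section Heights.

Lemma centeredK (a : 'Z_7) : (centered a)%:~R = a.
Proof.
by case: a => [[|[|[|[|[|[|[|//]]]]]]] Ha]; apply/val_inj.
Qed.

Lemma centered_step (a b : 'Z_7) : adj a b -> `|centered (b - a)| <= 1.
Proof.
rewrite /adj; move: (b - a) => e; rewrite !inE.
by move=> /or3P[] /eqP->.
Qed.

Definition lipschitz (f : int -> int) : Prop :=
  forall z, `|f (z + 1) - f z| <= 1.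

Lemma lipschitz_adj f : lipschitz f -> forall z, adj (f z)%:~R (f (z + 1))%:~R.
Proof.
move=> Lf z; move: (Lf z); move: (f (z + 1)) (f z) => p q pq.
have [->|[->|->]] : p = q \/ p = q + 1 \/ p = q - 1 by lia.
- by rewrite adj_refl.
- by rewrite /adj intrD addrC addKr.
- by rewrite /adj intrB addrC addKr.
Qed.

(** The lift starts at [c] and is constant before it. *)
Lemma integer_lift (a : int -> 'Z_7) (c : int) :
  (forall z, adj (a z) (a (z + 1))) ->
  exists h : int -> int, [/\ lipschitz h, forall z, c <= z -> (h z)%:~R = a z
    & 0 <= h c].
Proof.
move=> adja.
pose s (i : nat) := \sum_(j < i) centered (a (c + j%:Z + 1) - a (c + j%:Z)).
pose h (z : int) := ((a c : nat)%:Z : int) + s (absz (Num.max (z - c) 0)).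
have sS i : s i.+1 = s i + centered (a (c + i%:Z + 1) - a (c + i%:Z)).
  by rewrite /s big_ord_recr.
exists h; split.
- move=> z; rewrite /h; have [zc|zc] := leP c z; last first.
    by rewrite (_ : absz (Num.max (z + 1 - c) 0)%R = absz (Num.max (z - c) 0)%R) ?subrr //; lia.
  rewrite (_ : absz (Num.max (z + 1 - c) 0)%R = (absz (Num.max (z - c) 0)%R).+1); last lia.
  have := centered_step (adja (c + (absz (Num.max (z - c) 0)%R)%:Z)).
  rewrite sS; move: (s _) (centered _) => t e; lia.
- move=> z zc; rewrite /h.
  have [i ->] : exists i : nat, z = c + i%:Z by exists (absz (z - c)%R); lia.
  rewrite (_ : absz (Num.max (c + i%:Z - c) 0)%R = i); last lia.
  elim: i => [|i IH].
    rewrite /s big_ord0 !addr0; exact: natr_Zp.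
  rewrite sS addrA intrD IH centeredK addrC subrK.
  by congr a; lia.
- by rewrite /h subrr maxxx /s big_ord0 addr0.
Qed.

(** The lift is followed on the window, and brought down to zero with slope 1
    outside of it. *)
Lemma finite_heights (a : int -> 'Z_7) (n : nat) :
  (forall z, adj (a z) (a (z + 1))) ->
  exists f : int -> int, [/\ lipschitz f, forall z, 0 <= f z,
     exists N : nat, forall z, N%:Z < `|z| -> f z = 0
     & forall z, `|z| <= n%:Z -> (f z)%:~R = a z].
Proof.
move=> adja; have [h [Lh ha h0]] := integer_lift (- n%:Z) adja.
have grow (i : nat) : `|h (- n%:Z + i%:Z) - h (- n%:Z)| <= i%:Z.
  elim: i => [|i IH]; first by rewrite addr0 subrr.
  have := Lh (- n%:Z + i%:Z); rewrite (_ : - n%:Z + i%:Z + 1 = - n%:Z + i.+1%:Z); lia.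
pose p (z : int) : int := Num.max (- n%:Z) (Num.min n%:Z z).
have hp z : `|h (p z) - h (- n%:Z)| <= (2 * n)%N%:Z.
  have := grow (absz (p z + n%:Z)%R).
  by rewrite (_ : - n%:Z + _ = p z); rewrite /p; lia.
(* The multiple [14 * n] of 7 keeps the heights nonnegative on the window. *)
pose f (z : int) : int := Num.max 0 ((14 * n)%N%:Z + h (p z) - `|z - p z|).
exists f; split.
- move=> z; rewrite /f.
  have [e|[e1 e2]] : p (z + 1) = p z \/ p z = z /\ p (z + 1) = z + 1.
  + by rewrite /p; lia.
  + by rewrite e; move: (p z) (h (p z)) => q v; lia.
  + by have := Lh z; rewrite e1 e2 !subrr; move: (h _) (h _) => v v'; lia.
- by move=> z; rewrite /f; lia.
- exists (17 * n + absz (h (- n%:Z)))%N => z zN; have := hp z.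
  by rewrite /f /p; lia.
- move=> z zn; have pz : p z = z by rewrite /p; lia.
  rewrite /f pz subrr normr0 subr0.
  have := hp z; rewrite pz => hz.
  rewrite (_ : Num.max _ _ = (14 * n)%N%:Z + h z); last lia.
  rewrite intrD ha; last lia.
  rewrite (_ : (14 * n)%N%:Z%:~R = 0 :> 'Z_7) ?add0r //.
  rewrite (_ : (14 * n = 7 * (2 * n))%N); last lia.
  by rewrite PoszM intrM (_ : 7%:Z%:~R = 0 :> 'Z_7) ?mul0r //; apply/val_inj.
Qed.

End Heights.

Section Chains.
Variables (R : realType) (F : nat -> {fset lattice}).
Hypothesis folnerF : is_folner R F.

Let E1 := cpe_rel R (subshift_act (X := island_shift)) F 1.

Lemma equiv_closure_equivalence (X : topologicalType) (S : set (X * X)) :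
  is_equivalence (equiv_closure S).
Proof.
split.
- by move=> x D [[r _ _] _]; exact: r.
- by move=> x y H D DS; have [[_ s _] _] := DS; apply: s; exact: H.
- move=> x y z H K D DS; have [[_ _ t] _] := DS.
  by apply: t; [exact: H | exact: K].
Qed.

Let E1_sub : E1 `<=` equiv_closure E1.
Proof. exact: sub_smallest. Qed.

Definition height_point (f : int -> int) (Lf : lipschitz f) : island_shift :=
  point_of (pure_stacked (lipschitz_adj Lf)).

Lemma stack_height_point f (Lf : lipschitz f) :
  stack (height_point Lf) = pure_stack (fun z => (f z)%:~R).
Proof. exact: point_ofK. Qed.

Lemma lipschitz0 : lipschitz (fun=> 0).
Proof. by move=> z; rewrite subrr. Qed.

Lemma single_step f g (Lf : lipschitz f) (Lg : lipschitz g) z0 :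
  (forall z, z != z0 -> f z = g z) -> E1 (height_point Lf, height_point Lg).
Proof.
move=> fg; apply: isolated_entropy_pair => // z; rewrite !stack_height_point.
have C z' : z' != z0 -> calm (pure_stack (fun z => (f z)%:~R))
    (pure_stack (fun z => (g z)%:~R)) z'.
  by move=> /fg e; split => //; rewrite /pure_stack e.
have [e|e] := eqVneq z z0; last by left; exact: C.
by right; apply: C; rewrite e; lia.
Qed.

(** Heights are lowered to zero one plane at a time, always at a plane of
    maximal height: its two neighbors are at most one below, so that the
    lowered heights are still 1-Lipschitz. *)
Lemma flatten_heights (N : nat) f (Lf : lipschitz f) : (forall z, 0 <= f z) ->
  (forall z, N%:Z < `|z| -> f z = 0) ->
  equiv_closure E1 (height_point Lf, height_point lipschitz0).
Proof.
have [refl sym trans] := equiv_closure_equivalence E1.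
pose at_ (i : 'I_(2 * N).+1) : int := (i : nat)%:Z - N%:Z.
pose mass f := (\sum_i absz (f (at_ i)))%N.
have [m] := ubnP (mass f); elim: m f Lf => // m IH f Lf fm f0 fN.
pose i0 : 'I_(2 * N).+1 := ord0.
case: (@arg_maxnP _ i0 xpredT (fun i => absz (f (at_ i))) isT) => i _ imax.
pose z0 := at_ i.
have zmax z : f z <= f z0.
  have [h|h] := ltP N%:Z `|z|; first by rewrite fN.
  have lt : (absz (z + N%:Z)%R < (2 * N).+1)%N by lia.
  have := imax (Ordinal lt) isT; rewrite /at_ /=.
  rewrite (_ : (absz (z + N%:Z)%R)%:Z - N%:Z = z); last lia.
  by have := f0 z; have := f0 z0; rewrite /z0 /at_; lia.
have z0E : at_ i = z0 by [].
clearbody z0.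
have [z00|z0pos] := eqVneq (f z0) 0.
  have e : f = fun=> 0 by apply/funext => z; have := zmax z; have := f0 z; lia.
  rewrite (_ : height_point Lf = height_point lipschitz0); first exact: refl.
  by apply: stack_inj; rewrite !stack_height_point e.
have z01 : 0 < f z0 by rewrite lt_neqAle eq_sym z0pos f0.
pose g (z : int) : int := if z == z0 then f z - 1 else f z.
have Lg : lipschitz g.
  move=> z; rewrite /g; have := Lf z.
  have [e1|n1] := eqVneq (z + 1) z0; have [e2|n2] := eqVneq z z0; try lia.
    by have := zmax z; rewrite -e1; lia.
  by have := zmax (z + 1); rewrite -e2; lia.
apply: (trans _ (height_point Lg)).
  by apply: E1_sub; apply: (@single_step _ _ _ _ z0) => z /negbTE; rewrite /g => ->.
apply: IH.
- rewrite ltnS in fm; apply: leq_trans fm; rewrite /mass (bigD1 i) //= [ltnRHS](bigD1 i) //= -addSn.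
  apply: leq_add.
    by rewrite z0E /g eqxx; have := f0 z0; lia.
  apply: leq_sum => j _; rewrite /g; case: ifP => // /eqP ->.
  by move: (f z0) z01; lia.
- move=> z; rewrite /g; case: eqP => [->|_]; last exact: f0.
  by move: (f z0) z01; lia.
- move=> z zN; rewrite /g; case: eqP => [e|_]; last exact: fN.
  by move: z0pos; rewrite -e fN // eqxx.
Qed.

(** The planes that purification changes are not pure, so that no two of them are
    adjacent. *)
Lemma purify_pair (u p : island_shift) :
  stack p = pure_stack (fun z => mid (stack u z)) -> E1 (u, p).
Proof.
move=> e; apply: isolated_entropy_pair => // z; rewrite e.
have C z' : (forall x y, land (stack u z') x y) ->
    calm (stack u) (pure_stack (fun z => mid (stack u z))) z'.
  by have [ok _] := stackP u z' => full; split; rewrite /pure_stack -full_pure.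
have [ok st] := stackP u z; have [ok1 _] := stackP u (z + 1).
by have [full|full] := stack_full ok ok1 st; [left | right]; exact: C.
Qed.

(** Outside of the window [u] is replaced by pure planes whose heights come down
    to zero; the result is purified, then flattened. *)
Lemma connected_to_flat (u : island_shift) (n : nat) : exists2 w : island_shift,
  (forall z x y, `|z| <= n%:Z -> stack w z x y = stack u z x y) &
  equiv_closure E1 (w, height_point lipschitz0).
Proof.
have [refl sym trans] := equiv_closure_equivalence E1.
have adjm z : adj (mid (stack u z)) (mid (stack u (z + 1))).
  by have [_ /stack_mid] := stackP u z.
have [f [Lf f0 [N fN] fu]] := finite_heights n.+1 adjm.
have st : stacked (fun z => if `|z| <= n%:Z then stack u z else pure (f z)%:~R).
  apply: glue_stacked; first exact: lipschitz_adj.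
  move=> z zn; exists (stack u); first exact: stackP.
  by move=> z' zz'; split => //; apply: fu; lia.
exists (point_of st); first by move=> z x y zn; rewrite point_ofK zn.
apply: (trans _ (height_point Lf)); last exact: flatten_heights fN.
apply: E1_sub; apply: purify_pair; rewrite stack_height_point point_ofK.
apply/funext => z; rewrite /pure_stack; case: ifP => // zn.
by rewrite fu //; lia.
Qed.

(** Near any pair there is a pair of points both connected to the flat one. *)
Lemma cpe2_dense : closure (equiv_closure E1) = setT.
Proof.
have [refl sym trans] := equiv_closure_equivalence E1.
apply/seteqP; split => // -[u v] _ U [[/= U1 U2] [/= nU1 nU2] U12].
have [n1 H1] := nbhs_stack nU1; have [n2 H2] := nbhs_stack nU2.
have [w1 w1u w1f] := connected_to_flat u n1.
have [w2 w2v w2f] := connected_to_flat v n2.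
exists (w1, w2); split.
  by apply: trans w1f _; apply: sym.
by apply: U12; split => /=; [apply: H1 | apply: H2] => z x y zn _ _; auto.
Qed.

End Chains.

Theorem theorem6p21 (R : realType) :
  exists (A : finType) (X : subshift 'rV[int]_3 A),
    [/\ is_sft X,
        topologically_weakly_mixing (subshift_act (X := X))
      & forall F : nat -> {fset 'rV[int]_3},
          is_folner R F -> in_cpe_class R (subshift_act (X := X)) F 3].
Proof.
exists cell, island_shift; split.
- exact: local_shift_sft.
- exact: island_shift_weakly_mixing.
- move=> F folnerF; apply: in_cpe_class3; first exact: cpe2_proper.
  exact: cpe2_dense.
Qed.
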